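(* Let $m>0$. For $A>0$ consider the symmetric collinear four-body motion with masses $1,m,m,1$ and total energy $E=-1$ that starts at $t=0$ from a binary collision of the two inner bodies with $x_1(0)=A$, $x_2(0)=0$, $\dot x_1(0)=0$, $\dot x_2(0)=+\infty$ (understood through regularization). Let $t_1$ be the time at which the first simultaneous binary collision (SBC) happens. Then there exists $A_0>0$ such that the second body (with position $x_2$) has no turning point for $t\in(0,t_1]$ whenever $0<A\le A_0$. Further, the second body has at least one turning point for $t\in(0,t_1]$ if $A>A_0$.
   Context: Setting: four bodies on a line, numbered 1 to 4 from right to left, with masses $1,m,m,1$, positions $x_1,x_2,-x_2,-x_1$ (with $x_1\ge x_2\ge 0$) and velocities $\dot x_1,\dot x_2,-\dot x_2,-\dot x_1$. Away from collisions the motion satisfies $$\ddot{x}_1= -\frac{1}{4 x_1^2} -\frac{m}{(x_1+x_2)^2} -\frac{m}{(x_1-x_2)^2},\qquad \ddot{x}_2= -\frac{m}{4 x_2^2} -\frac{1}{(x_1+x_2)^2} +\frac{1}{(x_1-x_2)^2},$$ with total energy fixed to $$\dot x_1^2+m\dot x_2^2-\frac{1}{2x_1}-\frac{m^2}{2x_2}-\frac{2m}{x_1+x_2}-\frac{2m}{x_1-x_2}=E=-1.$$ A binary collision (BC) is a collision of the inner bodies 2 and 3 ($x_2=0<x_1$). A simultaneous binary collision (SBC) is a simultaneous collision of bodies 1 and 2 and of bodies 3 and 4 ($x_1=x_2>0$). Regularization: the singular initial condition, and continuation through BC and SBC, are understood via the variables $Q_1,Q_2,P_1,P_2$ with $Q_1^2=x_1-x_2$,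 $Q_2^2=2x_2$, $P_1=2Q_1p_1$, $P_2=2Q_2p_2$, where $p_1=2\dot x_1$ and $p_2=\dot x_1+m\dot x_2$, and the new time $s$ with $\frac{dt}{ds}=Q_1^2Q_2^2$ (and $t=0$ at $s=0$). In these variables the motion is given by Hamilton's equations $Q_i'=\partial\Gamma/\partial P_i$, $P_i'=-\partial\Gamma/\partial Q_i$ (with $'=d/ds$) on the level $\Gamma=0$ of $$\Gamma=\frac{1}{16}Q_2^2P_1^2+\frac{Q_2^2P_1^2-4Q_1Q_2P_1P_2+4Q_1^2P_2^2}{16m}-m^2Q_1^2-2mQ_2^2-\frac{2mQ_1^2Q_2^2}{Q_1^2+Q_2^2}-\frac{Q_1^2Q_2^2}{2Q_1^2+Q_2^2}+Q_1^2Q_2^2 .$$ The initial conditions correspond to $Q_1(0)=R$, $Q_2(0)=0$, $P_1(0)=0$, $P_2(0)=2m^{3/2}$ with $R=\sqrt{A}$. Definition (turning point): suppose a body has velocity $v=0$ at time $t^*$. If there is an interval $[t_a,t_b]$ with $t_a<t^*<t_b$ such that either $v>0$ on $[t_a,t^* )$ and $v<0$ on $(t^*,t_b]$, or $v<0$ on $[t_a,t^* )$ and $v>0$ on $(t^*,t_b]$, then $t^*$ is called a turning time and the position of the body at $t^*$ a turning point. ''The body has a turning point for $t\in(0,t_1]$'' means that there is a turning time $t^*\in(0,t_1]$. *)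

(* Defs.v *)
From Stdlib Require Import Reals.
From Coquelicot Require Import Coquelicot.
Open Scope R_scope.

(* The regularized Hamiltonian [Q1^2 Q2^2 (H - E)] for [E = -1]. *)
Definition Gam (m q1 q2 p1 p2 : R) : R :=
  1 / 16 * q2 ^ 2 * p1 ^ 2
  + (q2 ^ 2 * p1 ^ 2 - 4 * q1 * q2 * p1 * p2 + 4 * q1 ^ 2 * p2 ^ 2) / (16 * m)
  - m ^ 2 * q1 ^ 2 - 2 * m * q2 ^ 2
  - 2 * m * q1 ^ 2 * q2 ^ 2 / (q1 ^ 2 + q2 ^ 2)
  - q1 ^ 2 * q2 ^ 2 / (2 * q1 ^ 2 + q2 ^ 2)
  + q1 ^ 2 * q2 ^ 2.

(* The regularized motion on the open interval (a, b) of the fictitious time s,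
   with [tau s] the physical time.  Total collapse [Q1 = Q2 = 0], where [Gam] is
   singular (division by zero returns a default value), is excluded. *)
Record regularized_motion (m A a b : R) (Q1 Q2 P1 P2 tau : R -> R) : Prop := {
  rm_Q1 : forall s, a < s < b ->
    is_derive Q1 s (Derive (fun p => Gam m (Q1 s) (Q2 s) p (P2 s)) (P1 s));
  rm_Q2 : forall s, a < s < b ->
    is_derive Q2 s (Derive (fun p => Gam m (Q1 s) (Q2 s) (P1 s) p) (P2 s));
  rm_P1 : forall s, a < s < b ->
    is_derive P1 s (- Derive (fun q => Gam m q (Q2 s) (P1 s) (P2 s)) (Q1 s));
  rm_P2 : forall s, a < s < b ->
    is_derive P2 s (- Derive (fun q => Gam m (Q1 s) q (P1 s) (P2 s)) (Q2 s));
  rm_level : forall s, a < s < b -> Gam m (Q1 s) (Q2 s) (P1 s) (P2 s) = 0;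
  rm_no_collapse : forall s, a < s < b -> Q1 s <> 0 \/ Q2 s <> 0;
  rm_tau : forall s, a < s < b -> is_derive tau s (Q1 s ^ 2 * Q2 s ^ 2);
  rm_tau0 : tau 0 = 0;
  rm_Q1_0 : Q1 0 = sqrt A;
  rm_Q2_0 : Q2 0 = 0;
  rm_P1_0 : P1 0 = 0;
  rm_P2_0 : P2 0 = 2 * Rpower m (3 / 2)
}.

(* [x1], [x2] are the positions, as functions of physical time, along the motion
   started from the inner binary collision with [x1 = A].  The motion is defined
   on an open time interval containing [0, T]; outside it the values of [x1] and
   [x2] are irrelevant.  The equations for [x1] and [x2] invert
   [Q1^2 = x1 - x2], [Q2^2 = 2 x2]. *)
Definition motion_through (m A T : R) (x1 x2 : R -> R) : Prop :=
  exists (a b sT : R) (Q1 Q2 P1 P2 tau : R -> R),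
    a < 0 /\ 0 < sT < b /\ tau sT = T /\
    regularized_motion m A a b Q1 Q2 P1 P2 tau /\
    forall s, a < s < b ->
      x1 (tau s) = Q1 s ^ 2 + Q2 s ^ 2 / 2 /\ x2 (tau s) = Q2 s ^ 2 / 2.

Definition SBC (x1 x2 : R -> R) (t : R) : Prop := x1 t = x2 t /\ 0 < x2 t.

Definition first_SBC (x1 x2 : R -> R) (t1 : R) : Prop :=
  0 < t1 /\ SBC x1 x2 t1 /\ forall t, 0 < t < t1 -> ~ SBC x1 x2 t.

(* The velocity is the derivative of the position in physical time.  It does not
   exist at a collision, so a collision time is never a turning time. *)
Definition turning_time (x : R -> R) (ts : R) : Prop :=
  is_derive x ts 0 /\
  exists ta tb : R, ta < ts < tb /\
    (((forall t, ta <= t < ts -> exists v, is_derive x t v /\ v > 0) /\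
      (forall t, ts < t <= tb -> exists v, is_derive x t v /\ v < 0))
     \/
     ((forall t, ta <= t < ts -> exists v, is_derive x t v /\ v < 0) /\
      (forall t, ts < t <= tb -> exists v, is_derive x t v /\ v > 0))).

Definition has_turning_point (x : R -> R) (t1 : R) : Prop :=
  exists ts : R, 0 < ts <= t1 /\ turning_time x ts.

(* Main.v *)
Require Import Defs.
From Stdlib Require Import Reals Lra Classical.
From Coquelicot Require Import Coquelicot.
Open Scope R_scope.

(* In physical time the motion solves, up to the first collision, a system that is
   cooperative in [(- x1, x2)].  Lowering [A] at fixed energy lowers [x1] and raises
   the energy of the inner pair at the start, hence by comparison it lowers [x1] and
   raises [x2] and its velocity for as long as both motions are collision free.  A
   turning point of body 2 before the first SBC exists exactly when its velocity
   becomes negative before the first collision: where the velocity first vanishes the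
   acceleration is nonpositive, and if it is zero too then its derivative is positive,
   so the velocity does not change sign.  Hence the set of [A] without turning point
   is downward closed.  It contains [(0, 1/2]], where the inner pair has nonnegative
   energy, and it is bounded, since for large [A] the inner pair is tightly bound.
   It contains its supremum because a reversal persists under small changes of [A].
   This openness is a Gronwall estimate, started at the singular collision with the
   help of the energy relation; the case of equal [A] is the uniqueness of the motion.
   Existence of motions is never needed. *)

(** Comparing two motions requires a common clock, but the regularized time runs at a rate that
    depends on the motion. Hence the return to physical time, at the price of a singular start: [v2]
    is infinite there, [acc2] is not Lipschitz, and the difference of two velocities [v2] has no
    evident limit. What survives is the inner energy [m v2^2 - m^2 / (2 x2)], a difference of two
    infinite terms with a finite limit fixed by [A]. It separates two starts with different [A], and
    because [/ x2] decreases in [x2] it also controls how fast two values of [x2] drift apart. A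
    second obstacle is that the kind of the next collision is not known beforehand. If [v2] stays
    nonnegative, [x2] cannot return to 0, so that collision is an SBC. Absence of a reversal is
    therefore the assumption from which most steps argue by contradiction. *)

(** * One-sided limits, continuation arguments and differential inequalities *)

Lemma at_right0_iff (P : R -> Prop) :
  at_right 0 P <-> exists d, 0 < d /\ forall t, 0 < t < d -> P t.
Proof.
  split.
  - intros [d Hd]. exists d. split; [apply cond_pos|].
    intros t Ht. apply Hd; [|lra].
    change (Rabs (t - 0) < d). rewrite Rabs_pos_eq; lra.
  - intros [d [Hd H]]. exists (mkposreal d Hd). intros t Ht Ht0.
    change (Rabs (t - 0) < d) in Ht. rewrite Rabs_pos_eq in Ht; [|lra].
    apply H; lra.
Qed.

Lemma at_left_iff (c : R) (P : R -> Prop) :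
  at_left c P <-> exists d, 0 < d /\ forall t, c - d < t < c -> P t.
Proof.
  split.
  - intros [d Hd]. exists d. split; [apply cond_pos|].
    intros t Ht. apply Hd; [|lra].
    change (Rabs (t - c) < d). rewrite Rabs_left; lra.
  - intros [d [Hd H]]. exists (mkposreal d Hd). intros t Ht Ht0.
    change (Rabs (t - c) < d) in Ht. rewrite Rabs_left in Ht; [|lra].
    apply H; lra.
Qed.

Lemma at_right0_below (a : R) : 0 < a -> at_right 0 (fun t => 0 < t < a).
Proof. intros Ha. apply at_right0_iff. exists a. now split. Qed.

Lemma locally_R (c : R) (P : R -> Prop) :
  locally c P <-> exists d, 0 < d /\ forall t, c - d < t < c + d -> P t.
Proof.
  split.
  - intros [d Hd]. exists d. split; [apply cond_pos|].
    intros t Ht. apply Hd. change (Rabs (t - c) < d). apply Rabs_def1; lra.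
  - intros [d [Hd H]]. exists (mkposreal d Hd). intros t Ht.
    change (Rabs (t - c) < d) in Ht. apply Rabs_def2 in Ht. apply H; simpl in *; lra.
Qed.

Lemma filterlim_near {T : Type} {F : (T -> Prop) -> Prop}
  (f : T -> R) (l e : R) :
  filterlim f F (locally l) -> 0 < e -> F (fun t => l - e < f t < l + e).
Proof.
  intros H He. apply (H (fun y => l - e < y < l + e)).
  apply locally_R. exists e. split; [exact He | auto].
Qed.

Lemma filterlim_sub {T : Type} {F : (T -> Prop) -> Prop} {FF : Filter F}
  (f g : T -> R) (a b l : R) :
  filterlim f F (locally a) -> filterlim g F (locally b) -> l = a - b ->
  filterlim (fun t => f t - g t) F (locally l).
Proof.
  intros Hf Hg ->.
  apply filterlim_comp_2 with (1 := Hf) (3 := filterlim_plus a (- b)).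
  exact (filterlim_comp _ _ _ _ _ _ _ _ Hg (filterlim_opp b)).
Qed.

Lemma is_derive_sq (f : R -> R) (t d : R) :
  is_derive f t d -> is_derive (fun r => f r ^ 2) t (2 * f t * d).
Proof.
  intros Hd. evar_last; [exact (is_derive_pow f 2 t d Hd)|]. simpl. ring.
Qed.

Lemma filterlim_sq {T : Type} {F : (T -> Prop) -> Prop} {FF : Filter F}
  (f : T -> R) (a : R) :
  filterlim f F (locally a) -> filterlim (fun t => f t ^ 2) F (locally (a ^ 2)).
Proof.
  intros H. apply (filterlim_comp _ _ _ f (fun y => y ^ 2) F (locally a)); [exact H|].
  apply (ex_derive_continuous (fun y : R => y ^ 2)). auto_derive. trivial.
Qed.

Lemma filterlim_add {T : Type} {F : (T -> Prop) -> Prop} {FF : Filter F}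
  (f g : T -> R) (a b l : R) :
  filterlim f F (locally a) -> filterlim g F (locally b) -> l = a + b ->
  filterlim (fun t => f t + g t) F (locally l).
Proof.
  intros Hf Hg ->.
  apply filterlim_comp_2 with (1 := Hf) (2 := Hg) (3 := filterlim_plus a b).
Qed.

(** [c] is the supremum of the initial interval on which [P] holds. Denying [locally c P] rather
    than [P c] covers both a failure at [c] and failures that accumulate at [c] from the right. *)
Lemma first_failure (P : R -> Prop) (T : R) :
  at_right 0 P -> 0 < T -> ~ P T ->
  exists c, 0 < c <= T /\ (forall t, 0 < t < c -> P t) /\ ~ locally c P.
Proof.
  intros H0 HT HnT.
  apply at_right0_iff in H0. destruct H0 as [d [Hd H0]].
  set (E := fun t => t <= T /\ forall s, 0 < s < t -> P s).
  destruct (completeness E) as [c [Hub Hlub]].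
  - exists T. intros t [Ht _]. exact Ht.
  - exists 0. split; [lra|]. intros s Hs; lra.
  - assert (HcT : c <= T) by (apply Hlub; intros t [Ht _]; exact Ht).
    assert (Hc0 : 0 < c).
    { apply Rlt_le_trans with (Rmin d T); [apply Rmin_pos; lra|].
      apply Hub. split; [apply Rmin_r|]. intros s Hs. apply H0.
      generalize (Rmin_l d T); lra. }
    assert (Hc : forall t, 0 < t < c -> P t).
    { intros t Ht. apply NNPP. intro Hn.
      assert (c <= t); [|lra]. apply Hlub. intros r [Hr1 Hr2].
      apply Rnot_lt_le. intro Hlt. apply Hn, Hr2; lra. }
    exists c. split; [lra|]. split; [exact Hc|].
    intro Hl. assert (HPc := locally_singleton _ _ Hl).
    apply locally_R in Hl. destruct Hl as [e [He Hl]].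
    destruct (Rle_lt_or_eq_dec _ _ HcT) as [Hlt|Heq].
    + assert (Hm : 0 < Rmin (T - c) (e / 2)) by (apply Rmin_pos; lra).
      assert (c + Rmin (T - c) (e / 2) <= c); [|lra].
      apply Hub. split; [generalize (Rmin_l (T - c) (e / 2)); lra|].
      intros s Hs. destruct (Rlt_or_le s c); [apply Hc; lra|].
      apply Hl. generalize (Rmin_r (T - c) (e / 2)); lra.
    + now subst.
Qed.

Lemma real_induction (P : R -> Prop) (T : R) :
  at_right 0 P ->
  (forall c, 0 < c < T -> (forall t, 0 < t < c -> P t) -> locally c P) ->
  forall t, 0 < t < T -> P t.
Proof.
  intros H0 Hstep t Ht. apply NNPP. intro Hn.
  destruct (first_failure P t H0 (proj1 Ht) Hn) as [c [Hc [H1 H2]]].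
  apply H2, Hstep; [lra | exact H1].
Qed.

Lemma derive_gt (f df : R -> R) (M s t : R) :
  s < t -> (forall r, s <= r <= t -> is_derive f r (df r) /\ M < df r) ->
  M * (t - s) < f t - f s.
Proof.
  intros Hst H.
  destruct (MVT_gen f s t df) as [c [Hc E]].
  - intros r Hr. rewrite Rmin_left, Rmax_right in Hr by lra. apply H; lra.
  - intros r Hr. rewrite Rmin_left, Rmax_right in Hr by lra.
    apply continuity_pt_filterlim, (ex_derive_continuous f).
    exists (df r). apply H; lra.
  - rewrite Rmin_left, Rmax_right in Hc by lra.
    rewrite E. apply Rmult_lt_compat_r; [lra|]. now apply H.
Qed.

Lemma derive_ge (f df : R -> R) (M s t : R) :
  s <= t -> (forall r, s <= r <= t -> is_derive f r (df r) /\ M <= df r) ->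
  M * (t - s) <= f t - f s.
Proof.
  intros Hst H.
  destruct (Req_dec s t) as [->|Hne]; [lra|].
  destruct (MVT_gen f s t df) as [c [Hc E]].
  - intros r Hr. rewrite Rmin_left, Rmax_right in Hr by lra. apply H; lra.
  - intros r Hr. rewrite Rmin_left, Rmax_right in Hr by lra.
    apply continuity_pt_filterlim, (ex_derive_continuous f).
    exists (df r). apply H; lra.
  - rewrite Rmin_left, Rmax_right in Hc by lra.
    rewrite E. apply Rmult_le_compat_r; [lra|]. now apply H.
Qed.

Lemma derive_le (f df : R -> R) (M s t : R) :
  s <= t -> (forall r, s <= r <= t -> is_derive f r (df r) /\ df r <= M) ->
  f t - f s <= M * (t - s).
Proof.
  intros Hst H.
  generalize (derive_ge (fun r => - f r) (fun r => - df r) (- M) s t Hst).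
  intros G. enough (- M * (t - s) <= - f t - - f s) by lra. apply G.
  intros r Hr. destruct (H r Hr) as [H1 H2]. split; [|lra].
  exact (is_derive_opp f r _ H1).
Qed.

Lemma lim0_le (f : R -> R) (l M T : R) :
  filterlim f (at_right 0) (locally l) -> 0 < T ->
  (forall t, 0 < t < T -> f t <= M) -> l <= M.
Proof.
  intros Hl HT H. apply Rnot_lt_le. intro Hlt.
  assert (G := filter_and (F := at_right 0) _ _ (filterlim_near f l (l - M) Hl ltac:(lra))
                 (at_right0_below T HT)).
  destruct (filter_ex (F := at_right 0) _ G) as [t [H1 H2]]. generalize (H t H2); lra.
Qed.

Lemma lim0_ge (f : R -> R) (l M T : R) :
  filterlim f (at_right 0) (locally l) -> 0 < T ->
  (forall t, 0 < t < T -> M <= f t) -> M <= l.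
Proof.
  intros Hl HT H. apply Rnot_lt_le. intro Hlt.
  assert (G := filter_and (F := at_right 0) _ _ (filterlim_near f l (M - l) Hl ltac:(lra))
                 (at_right0_below T HT)).
  destruct (filter_ex (F := at_right 0) _ G) as [t [H1 H2]]. generalize (H t H2); lra.
Qed.

(** At the collision only a limit of [f] is available, so the mean value bound is applied on
    [[s, t]] and [s] tends to 0. *)
Lemma derive_le_lim0 (f df : R -> R) (l M t : R) :
  filterlim f (at_right 0) (locally l) -> 0 < t ->
  (forall r, 0 < r <= t -> is_derive f r (df r) /\ df r <= M) ->
  0 <= M -> f t <= l + M * t.
Proof.
  intros Hl Ht H HM.
  enough (f t - M * t <= l) by lra.
  apply (lim0_ge f l _ t Hl Ht). intros s Hs.
  assert (f t - f s <= M * (t - s)).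
  { apply (derive_le f df); [lra|]. intros r Hr; apply H; lra. }
  nra.
Qed.

Lemma derive_nonneg_lim0 (f df : R -> R) (l t : R) :
  filterlim f (at_right 0) (locally l) -> 0 < t ->
  (forall r, 0 < r <= t -> is_derive f r (df r) /\ 0 <= df r) -> l <= f t.
Proof.
  intros Hl Ht H.
  apply (lim0_le f l _ t Hl Ht). intros s Hs.
  assert (0 * (t - s) <= f t - f s); [|lra].
  apply (derive_ge f df); [lra|]. intros r Hr; apply H; lra.
Qed.

Lemma is_derive_locally_gt (f : R -> R) (c d M : R) :
  is_derive f c d -> M < f c -> locally c (fun t => M < f t).
Proof.
  intros Hd Hc.
  assert (Hf : continuous f c) by (apply (ex_derive_continuous f); now exists d).
  apply (Hf (fun y => M < y)). apply locally_R.
  exists (f c - M). split; [lra|]. intros; lra.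
Qed.

Lemma is_derive_locally_lt (f : R -> R) (c d M : R) :
  is_derive f c d -> f c < M -> locally c (fun t => f t < M).
Proof.
  intros Hd Hc.
  assert (Hf : continuous f c) by (apply (ex_derive_continuous f); now exists d).
  apply (Hf (fun y => y < M)). apply locally_R.
  exists (M - f c). split; [lra|]. intros; lra.
Qed.

Lemma is_derive_pos_sign (f : R -> R) (c d : R) :
  is_derive f c d -> 0 < d ->
  exists e, 0 < e /\ (forall t, c - e < t < c -> f t < f c) /\
    (forall t, c < t < c + e -> f c < f t).
Proof.
  intros Hd Hpos. apply is_derive_Reals in Hd.
  destruct (Hd d Hpos) as [e He].
  assert (K : forall t, t <> c -> c - e < t < c + e -> 0 < (f t - f c) / (t - c)).
  { intros t Hne Ht. specialize (He (t - c) ltac:(lra)).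
    replace (c + (t - c)) with t in He by ring.
    assert (Rabs (t - c) < e) as Ha by (apply Rabs_def1; lra).
    apply Rabs_def2 in He; [lra|exact Ha]. }
  exists e. split; [apply cond_pos|]. split; intros t Ht.
  - specialize (K t ltac:(lra) ltac:(lra)).
    apply Rnot_le_lt. intro.
    assert ((f t - f c) = (f t - f c) / (t - c) * (t - c)) by (field; lra). nra.
  - specialize (K t ltac:(lra) ltac:(lra)).
    apply Rnot_le_lt. intro.
    assert ((f t - f c) = (f t - f c) / (t - c) * (t - c)) by (field; lra). nra.
Qed.

Lemma gronwall (k dk : R -> R) (L s t : R) :
  s <= t -> (forall r, s <= r <= t -> is_derive k r (dk r) /\ dk r <= L * k r) ->
  k t <= k s * exp (L * (t - s)).
Proof.
  intros Hst H.
  assert (G : k t * exp (- L * t) - k s * exp (- L * s) <= 0 * (t - s)).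
  { apply (derive_le (fun r => k r * exp (- L * r))
             (fun r => (dk r - L * k r) * exp (- L * r))); [exact Hst|].
    intros r Hr. destruct (H r Hr) as [H1 H2]. split.
    - evar_last.
      + apply (is_derive_mult k (fun r => exp (- L * r)) r); [exact H1| |intros; apply Rmult_comm].
        auto_derive; [trivial|reflexivity].
      + unfold plus, mult; simpl. ring.
    - generalize (exp_pos (- L * r)); nra. }
  apply Rmult_le_reg_r with (exp (- L * t)); [apply exp_pos|].
  rewrite Rmult_assoc, <- exp_plus.
  replace (L * (t - s) + - L * t) with (- L * s) by ring. lra.
Qed.

Lemma gronwall_lim0 (k dk : R -> R) (L l t : R) :
  filterlim k (at_right 0) (locally l) -> 0 < t -> 0 <= L -> 0 <= l ->
  (forall r, 0 < r <= t -> is_derive k r (dk r) /\ dk r <= L * k r) ->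
  k t <= l * exp (L * t).
Proof.
  intros Hl Ht HL Hl0 H.
  assert (Hp := exp_pos (L * t)).
  assert (K : k t * / exp (L * t) <= l).
  (* As [l] is nonnegative, only [k t > 0] matters; then every [k s] is positive, which allows
     [L * (t - s)] to be enlarged to [L * t]. *)
  { destruct (Rle_lt_dec (k t) 0) as [Hneg|Hkt].
    - assert (0 < / exp (L * t)) by now apply Rinv_0_lt_compat. nra.
    - apply (lim0_ge k l _ t Hl Ht). intros s Hs.
      assert (G : k t <= k s * exp (L * (t - s))).
      { apply (gronwall k dk); [lra|]. intros r Hr; apply H; lra. }
      assert (exp (L * (t - s)) <= exp (L * t)).
      { destruct (Req_dec (L * s) 0) as [Hz|Hz].
        - right. f_equal. lra.
        - left. apply exp_increasing. nra. }
      assert (0 < k s) by (generalize (exp_pos (L * (t - s))); nra).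
      apply Rmult_le_reg_r with (exp (L * t)); [exact Hp|].
      rewrite Rmult_assoc, Rinv_l by lra. nra. }
  apply Rmult_le_reg_r with (/ exp (L * t)); [now apply Rinv_0_lt_compat|].
  rewrite Rmult_assoc, Rinv_r by lra. lra.
Qed.

Lemma inv_diff_le (c z p q : R) :
  0 < c -> c <= p -> c <= q -> q - p <= z -> 0 <= z -> / p - / q <= z / c ^ 2.
Proof.
  intros Hc Hp Hq Hz Hz0.
  replace (/ p - / q) with ((q - p) * (/ p * / q)) by (field; lra).
  replace (z / c ^ 2) with (z * (/ c * / c)) by (field; lra).
  assert (0 < / p) by (apply Rinv_0_lt_compat; lra).
  assert (0 < / q) by (apply Rinv_0_lt_compat; lra).
  assert (/ p <= / c) by (apply Rinv_le_contravar; lra).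
  assert (/ q <= / c) by (apply Rinv_le_contravar; lra).
  assert (/ p * / q <= / c * / c) by nra.
  assert (0 < / p * / q) by nra. nra.
Qed.

Lemma inv_sq_diff_le (c z p q : R) :
  0 < c -> c <= p -> c <= q -> q - p <= z -> 0 <= z ->
  / p ^ 2 - / q ^ 2 <= 2 * z / c ^ 3.
Proof.
  intros Hc Hp Hq Hz Hz0.
  replace (/ p ^ 2 - / q ^ 2) with ((/ p - / q) * (/ p + / q)) by (field; lra).
  replace (2 * z / c ^ 3) with (z / c ^ 2 * (2 * / c)) by (field; lra).
  assert (0 < / p) by (apply Rinv_0_lt_compat; lra).
  assert (0 < / q) by (apply Rinv_0_lt_compat; lra).
  assert (/ p <= / c) by (apply Rinv_le_contravar; lra).
  assert (/ q <= / c) by (apply Rinv_le_contravar; lra).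
  assert (/ p - / q <= z / c ^ 2) by now apply inv_diff_le.
  assert (0 <= z / c ^ 2) by (apply Rdiv_le_0_compat; [lra|nra]).
  nra.
Qed.

Lemma inv_sq_lt (p q : R) : 0 < p -> p < q -> / q ^ 2 < / p ^ 2.
Proof.
  intros Hp Hpq. apply Rinv_lt_contravar; [|nra].
  apply Rmult_lt_0_compat; apply pow_lt; lra.
Qed.

Lemma inv_sq_le (p q : R) : 0 < p -> p <= q -> / q ^ 2 <= / p ^ 2.
Proof. intros Hp Hpq. apply Rinv_le_contravar; nra. Qed.

Lemma derive_closure (a : R) (f : R -> R) (c d M : R) :
  is_derive f c d -> a < c -> (forall t, a < t < c -> M <= f t) -> M <= f c.
Proof.
  intros Hd Hc H. apply Rnot_lt_le. intro Hlt.
  assert (Hl := is_derive_locally_lt f c d M Hd Hlt).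
  apply locally_R in Hl. destruct Hl as [e [He Hl]].
  assert (Hm : 0 < Rmin (c - a) e) by (apply Rmin_pos; lra).
  assert (H1 := Rmin_l (c - a) e). assert (H2 := Rmin_r (c - a) e).
  generalize (Hl (c - Rmin (c - a) e / 2) ltac:(lra))
    (H (c - Rmin (c - a) e / 2) ltac:(lra)).
  lra.
Qed.

Lemma pos_lower_bound (f : R -> R) (a b : R) :
  a <= b -> (forall t, a <= t <= b -> ex_derive f t /\ 0 < f t) ->
  exists c, 0 < c /\ forall t, a <= t <= b -> c <= f t.
Proof.
  intros Hab H.
  destruct (continuity_ab_min f a b Hab) as [x [H1 H2]].
  - intros t Ht. apply continuity_pt_filterlim, (ex_derive_continuous f).
    now apply H.
  - exists (f x). split; [now apply H | exact H1].
Qed.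

(** Convexity of [/ r ^ 2], made explicit by factoring [w] out of the difference. *)
Lemma inv_sq_diff_decr (p q w : R) :
  0 < p -> p <= q -> 0 <= w ->
  / q ^ 2 - / (q + w) ^ 2 <= / p ^ 2 - / (p + w) ^ 2.
Proof.
  intros Hp Hq Hw.
  assert (E : forall r, 0 < r ->
    / r ^ 2 - / (r + w) ^ 2 = w * ((/ r * / (r + w)) * (/ r + / (r + w)))).
  { intros r Hr. field. lra. }
  rewrite !E by lra. apply Rmult_le_compat_l; [exact Hw|].
  assert (0 < / q) by (apply Rinv_0_lt_compat; lra).
  assert (0 < / (q + w)) by (apply Rinv_0_lt_compat; lra).
  assert (/ q <= / p) by (apply Rinv_le_contravar; lra).
  assert (/ (q + w) <= / (p + w)) by (apply Rinv_le_contravar; lra).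
  apply Rmult_le_compat; nra.
Qed.

(** * Motion between two collisions *)

Definition acc1 (m x1 x2 : R) : R :=
  - (/ x1 ^ 2 / 4) - m * / (x1 + x2) ^ 2 - m * / (x1 - x2) ^ 2.

Definition acc2 (m x1 x2 : R) : R :=
  - (m / 4 * / x2 ^ 2) - / (x1 + x2) ^ 2 + / (x1 - x2) ^ 2.

Definition outer_potential (m x1 x2 : R) : R :=
  / x1 / 2 + 2 * m * / (x1 + x2) + 2 * m * / (x1 - x2).

(** Energy of the inner pair alone. It stays finite at an inner collision, where both of its terms
    diverge. *)
Definition inner_energy (m x2 v2 : R) : R := m * v2 ^ 2 - m ^ 2 / 2 * / x2.

(* The motion in physical time from the inner collision at [0] to the next
   collision, of whichever kind, at [th]. *)
Record free_fall (m A th : R) (x1 x2 v1 v2 : R -> R) : Prop := {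
  ff_th : 0 < th;
  ff_order : forall t, 0 < t < th -> 0 < x2 t < x1 t;
  ff_x1 : forall t, 0 < t < th -> is_derive x1 t (v1 t);
  ff_x2 : forall t, 0 < t < th -> is_derive x2 t (v2 t);
  ff_v1 : forall t, 0 < t < th -> is_derive v1 t (acc1 m (x1 t) (x2 t));
  ff_v2 : forall t, 0 < t < th -> is_derive v2 t (acc2 m (x1 t) (x2 t));
  ff_energy : forall t, 0 < t < th ->
    inner_energy m (x2 t) (v2 t) = -1 - v1 t ^ 2 + outer_potential m (x1 t) (x2 t);
  ff_x1_0 : filterlim x1 (at_right 0) (locally A);
  ff_x2_0 : filterlim x2 (at_right 0) (locally 0);
  ff_v1_0 : filterlim v1 (at_right 0) (locally 0);
  ff_inner_0 : filterlim (fun t => inner_energy m (x2 t) (v2 t)) (at_right 0)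
                 (locally (-1 + (1 / 2 + 4 * m) / A));
  ff_v2_0 : at_right 0 (fun t => 0 < v2 t);
  ff_end : filterlim (fun t => x2 t * (x1 t - x2 t)) (at_left th) (locally 0)
}.

Lemma acc1_neg (m x1 x2 : R) : 0 < m -> 0 < x2 < x1 -> acc1 m x1 x2 < 0.
Proof.
  intros Hm Hx. unfold acc1.
  assert (0 < / x1 ^ 2) by (apply Rinv_0_lt_compat; nra).
  assert (0 < / (x1 + x2) ^ 2) by (apply Rinv_0_lt_compat; nra).
  assert (0 < / (x1 - x2) ^ 2) by (apply Rinv_0_lt_compat; nra).
  nra.
Qed.

(* The system is cooperative in [(- x1, x2)]. *)
Lemma acc_cooperative (m x1 x2 y1 y2 : R) :
  0 < m -> 0 < x2 -> x2 < y2 -> y2 < y1 -> y1 < x1 ->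
  acc1 m y1 y2 < acc1 m x1 x2 /\ acc2 m x1 x2 < acc2 m y1 y2.
Proof.
  intros Hm H1 H2 H3 H4. unfold acc1, acc2.
  (* [x1 + x2] and [y1 + y2] are not ordered, but they differ by at most [z], which is exactly the
     growth of the gap. The gap is the shorter distance, so by convexity its term outweighs the term
     of the sum. *)
  set (z := y2 - x2 + (x1 - y1)).
  assert (D1 := inv_sq_diff_decr (y1 - y2) (y1 + y2) z ltac:(lra) ltac:(lra)
                  ltac:(unfold z; lra)).
  assert (D2 := inv_sq_diff_decr (y1 - y2) (x1 + x2) z ltac:(lra) ltac:(lra)
                  ltac:(unfold z; lra)).
  replace (y1 - y2 + z) with (x1 - x2) in D1, D2 by (unfold z; ring).
  assert (E1 : / (y1 + y2 + z) ^ 2 <= / (x1 + x2) ^ 2)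
    by (apply inv_sq_le; unfold z; lra).
  assert (E2 : / (x1 + x2 + z) ^ 2 <= / (y1 + y2) ^ 2)
    by (apply inv_sq_le; unfold z; lra).
  assert (F1 : / x1 ^ 2 < / y1 ^ 2) by (apply inv_sq_lt; lra).
  assert (F2 : / y2 ^ 2 < / x2 ^ 2) by (apply inv_sq_lt; lra).
  split; nra.
Qed.

(** A bound on the gap also bounds [x1] and [x1 + x2] from below. Only [acc2] contains [/ x2 ^ 2],
    hence the separate [b]; the other two estimates remain uniform up to the inner collision. *)
Lemma acc_lipschitz_le (m c x1 x2 y1 y2 z : R) :
  0 < m -> 0 < c -> 0 < x2 -> 0 < y2 -> c <= x1 - x2 -> c <= y1 - y2 ->
  Rabs (y2 - x2) + Rabs (y1 - x1) <= z ->
  outer_potential m y1 y2 - outer_potential m x1 x2 <= (1 / 2 + 4 * m) / c ^ 2 * z /\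
  acc1 m x1 x2 - acc1 m y1 y2 <= (1 / 2 + 4 * m) / c ^ 3 * z /\
  forall b, 0 < b -> b <= x2 -> b <= y2 ->
    acc2 m y1 y2 - acc2 m x1 x2 <= (m / 2 / b ^ 3 + 4 / c ^ 3) * z.
Proof.
  intros Hm Hc Hx2 Hy2 Hx Hy Hz.
  unfold outer_potential, acc1, acc2.
  assert (A1 := Rle_abs (y2 - x2)). assert (A2 := Rle_abs (y1 - x1)).
  assert (A3 := Rle_abs (- (y2 - x2))). assert (A4 := Rle_abs (- (y1 - x1))).
  rewrite Rabs_Ropp in A3, A4.
  assert (I1 := inv_diff_le c z y1 x1 Hc ltac:(lra) ltac:(lra) ltac:(lra) ltac:(lra)).
  assert (I2 := inv_diff_le c z (y1 + y2) (x1 + x2) Hc ltac:(lra) ltac:(lra) ltac:(lra) ltac:(lra)).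
  assert (I3 := inv_diff_le c z (y1 - y2) (x1 - x2) Hc ltac:(lra) ltac:(lra) ltac:(lra) ltac:(lra)).
  assert (S1 := inv_sq_diff_le c z y1 x1 Hc ltac:(lra) ltac:(lra) ltac:(lra) ltac:(lra)).
  assert (S2 := inv_sq_diff_le c z (y1 + y2) (x1 + x2) Hc ltac:(lra) ltac:(lra) ltac:(lra) ltac:(lra)).
  assert (S3 := inv_sq_diff_le c z (y1 - y2) (x1 - x2) Hc ltac:(lra) ltac:(lra) ltac:(lra) ltac:(lra)).
  assert (S4 := inv_sq_diff_le c z (x1 + x2) (y1 + y2) Hc ltac:(lra) ltac:(lra) ltac:(lra) ltac:(lra)).
  split; [|split].
  - replace ((1 / 2 + 4 * m) / c ^ 2 * z) with ((1 / 2 + 4 * m) * (z / c ^ 2))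
      by (field; lra). nra.
  - replace ((1 / 2 + 4 * m) / c ^ 3 * z) with ((1 / 4 + 2 * m) * (2 * z / c ^ 3))
      by (field; lra). nra.
  - intros b Hb Hbx Hby.
    assert (S5 := inv_sq_diff_le b z x2 y2 Hb ltac:(lra) ltac:(lra) ltac:(lra) ltac:(lra)).
    replace ((m / 2 / b ^ 3 + 4 / c ^ 3) * z)
      with (m / 4 * (2 * z / b ^ 3) + 2 * (2 * z / c ^ 3)) by (field; lra). nra.
Qed.

Lemma acc_lipschitz (m c x1 x2 y1 y2 z : R) :
  0 < m -> 0 < c -> 0 < x2 -> 0 < y2 -> c <= x1 - x2 -> c <= y1 - y2 ->
  Rabs (y2 - x2) + Rabs (y1 - x1) <= z ->
  Rabs (outer_potential m y1 y2 - outer_potential m x1 x2)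
    <= (1 / 2 + 4 * m) / c ^ 2 * z /\
  Rabs (acc1 m x1 x2 - acc1 m y1 y2) <= (1 / 2 + 4 * m) / c ^ 3 * z /\
  forall b, 0 < b -> b <= x2 -> b <= y2 ->
    Rabs (acc2 m y1 y2 - acc2 m x1 x2) <= (m / 2 / b ^ 3 + 4 / c ^ 3) * z.
Proof.
  intros Hm Hc Hx2 Hy2 Hx Hy Hz.
  destruct (acc_lipschitz_le m c x1 x2 y1 y2 z Hm Hc Hx2 Hy2 Hx Hy Hz) as [B1 [B2 B3]].
  rewrite (Rabs_minus_sym y2 x2), (Rabs_minus_sym y1 x1) in Hz.
  destruct (acc_lipschitz_le m c y1 y2 x1 x2 z Hm Hc Hy2 Hx2 Hy Hx Hz) as [D1 [D2 D3]].
  split; [apply Rabs_le; lra|]. split; [apply Rabs_le; lra|].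
  intros b Hb Hbx Hby. specialize (B3 b Hb Hbx Hby). specialize (D3 b Hb Hby Hbx).
  apply Rabs_le. lra.
Qed.

Lemma free_fall_v1_neg (m A th : R) (x1 x2 v1 v2 : R -> R) :
  0 < m -> free_fall m A th x1 x2 v1 v2 -> forall t, 0 < t < th -> v1 t < 0.
Proof.
  intros Hm H t Ht.
  assert (Hneg : forall s, 0 < s < th -> v1 s <= 0).
  { intros s Hs.
    replace 0 with (0 + 0 * s) by ring.
    apply (derive_le_lim0 v1 (fun r => acc1 m (x1 r) (x2 r)) 0 0 s); try lra.
    - apply (ff_v1_0 _ _ _ _ _ _ _ H).
    - intros r Hr. split; [apply (ff_v1 _ _ _ _ _ _ _ H); lra|].
      left. apply acc1_neg; [exact Hm|]. apply (ff_order _ _ _ _ _ _ _ H); lra. }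
  assert (G : 0 * (t - t / 2) < - v1 t - - v1 (t / 2)).
  { apply (derive_gt (fun r => - v1 r) (fun r => - acc1 m (x1 r) (x2 r))); [lra|].
    intros r Hr. split.
    - apply (is_derive_opp v1 r), (ff_v1 _ _ _ _ _ _ _ H); lra.
    - generalize (acc1_neg m (x1 r) (x2 r) Hm (ff_order _ _ _ _ _ _ _ H r ltac:(lra))).
      lra. }
  generalize (Hneg (t / 2) ltac:(lra)). lra.
Qed.

(** The condition at [th] is a limit of a product because either factor may be the one that
    vanishes. Excluding the end of a motion thus takes lower bounds on both. *)
Lemma free_fall_not_end (m A th s a b : R) (x1 x2 v1 v2 : R -> R) :
  free_fall m A th x1 x2 v1 v2 -> s < th -> 0 < a -> 0 < b ->
  ~ (forall t, s < t < th -> a <= x2 t /\ b <= x1 t - x2 t).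
Proof.
  intros H Hs Ha Hb Hab.
  assert (G := filterlim_near _ _ (a * b) (ff_end _ _ _ _ _ _ _ H) ltac:(nra)).
  apply at_left_iff in G. destruct G as [d [Hd G]].
  assert (Hm : 0 < Rmin d (th - s)) by (apply Rmin_pos; lra).
  assert (H1 := Rmin_l d (th - s)). assert (H2 := Rmin_r d (th - s)).
  specialize (G (th - Rmin d (th - s) / 2) ltac:(lra)).
  destruct (Hab (th - Rmin d (th - s) / 2) ltac:(lra)). nra.
Qed.

Lemma free_fall_x2_mono (m A th T : R) (x1 x2 v1 v2 : R -> R) :
  free_fall m A th x1 x2 v1 v2 -> T <= th ->
  (forall t, 0 < t < T -> 0 <= v2 t) ->
  forall s t, 0 < s <= t -> t < T -> x2 s <= x2 t.
Proof.
  intros H HT Hv s t Hs Ht.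
  enough (0 * (t - s) <= x2 t - x2 s) by lra.
  apply (derive_ge x2 v2); [lra|]. intros r Hr. split.
  - apply (ff_x2 _ _ _ _ _ _ _ H); lra.
  - apply Hv; lra.
Qed.

(** The mutual attraction of the inner pair cancels. What remains is the work of the outer bodies,
    which has the sign of [v2] because the gap is the shorter distance. *)
Lemma inner_energy_derive (m A th t : R) (x1 x2 v1 v2 : R -> R) :
  free_fall m A th x1 x2 v1 v2 -> 0 < t < th ->
  is_derive (fun r => inner_energy m (x2 r) (v2 r)) t
    (2 * m * v2 t * (/ (x1 t - x2 t) ^ 2 - / (x1 t + x2 t) ^ 2)).
Proof.
  intros H Ht. assert (Ho := ff_order _ _ _ _ _ _ _ H t Ht).
  assert (D1 := ff_x2 _ _ _ _ _ _ _ H t Ht).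
  assert (D2 := ff_v2 _ _ _ _ _ _ _ H t Ht).
  unfold inner_energy. auto_derive.
  - repeat split; try lra; eexists; eassumption.
  - replace (Derive (fun r : R => x2 r) t) with (v2 t)
      by (symmetry; exact (is_derive_unique _ _ _ D1)).
    replace (Derive (fun r : R => v2 r) t) with (acc2 m (x1 t) (x2 t))
      by (symmetry; exact (is_derive_unique _ _ _ D2)).
    unfold acc2. field. lra.
Qed.

(** * The sign of [v2]: small [A], turning points, large [A] *)

(** A pair with nonnegative inner energy cannot come to rest, and this energy does not decrease
    while [v2 >= 0]. Its initial value is nonnegative for [A] up to [1 / 2 + 4 * m]; the value
    [1 / 2] is uniform in [m]. *)
Lemma no_reversal_small (m A th : R) (x1 x2 v1 v2 : R -> R) :
  0 < m -> 0 < A <= 1 / 2 -> free_fall m A th x1 x2 v1 v2 ->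
  forall t, 0 < t < th -> 0 < v2 t.
Proof.
  intros Hm HA H. apply real_induction; [apply (ff_v2_0 _ _ _ _ _ _ _ H)|].
  intros c Hc Hv.
  assert (D := ff_v2 _ _ _ _ _ _ _ H c Hc).
  assert (Hv0 : 0 <= v2 c).
  { apply (derive_closure 0 v2 c _ 0 D); [lra|]. intros t Ht. left. now apply Hv. }
  assert (He : -1 + (1 / 2 + 4 * m) / A <= inner_energy m (x2 c) (v2 c)).
  { apply (derive_nonneg_lim0 (fun r => inner_energy m (x2 r) (v2 r))
      (fun t => 2 * m * v2 t * (/ (x1 t - x2 t) ^ 2 - / (x1 t + x2 t) ^ 2)));
      [apply (ff_inner_0 _ _ _ _ _ _ _ H) | lra |].
    intros r Hr. split; [apply (inner_energy_derive _ _ _ _ _ _ _ _ H); lra|].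
    assert (Ho := ff_order _ _ _ _ _ _ _ H r ltac:(lra)).
    assert (/ (x1 r + x2 r) ^ 2 <= / (x1 r - x2 r) ^ 2) by (apply inv_sq_le; lra).
    assert (0 <= v2 r).
    { destruct (Req_dec r c) as [->|]; [exact Hv0|]. left. apply Hv; lra. }
    apply Rmult_le_pos; nra. }
  assert (H0 : 0 <= -1 + (1 / 2 + 4 * m) / A).
  { enough (1 <= (1 / 2 + 4 * m) / A) by lra.
    apply Rmult_le_reg_r with A; [lra|].
    unfold Rdiv. rewrite Rmult_assoc, Rinv_l by lra. lra. }
  assert (Hx : 0 < / x2 c).
  { apply Rinv_0_lt_compat. apply (ff_order _ _ _ _ _ _ _ H c Hc). }
  apply (is_derive_locally_gt v2 c _ 0 D).
  unfold inner_energy in He.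
  assert (0 < m ^ 2) by nra.
  assert (0 < m ^ 2 / 2 * / x2 c) by nra.
  destruct Hv0 as [|E]; [assumption|]. rewrite <- E in He. nra.
Qed.

(** At a zero of [v2] only [x1] moves to first order. Since [v1 < 0], the derivative is positive,
    which excludes a reversal with vanishing acceleration. *)
Lemma acc2_derive (m A th t : R) (x1 x2 v1 v2 : R -> R) :
  free_fall m A th x1 x2 v1 v2 -> 0 < t < th -> v2 t = 0 ->
  is_derive (fun r => acc2 m (x1 r) (x2 r)) t
    (2 * v1 t * (/ (x1 t + x2 t) ^ 3 - / (x1 t - x2 t) ^ 3)).
Proof.
  intros H Ht Hv. assert (Ho := ff_order _ _ _ _ _ _ _ H t Ht).
  assert (D1 := ff_x1 _ _ _ _ _ _ _ H t Ht).
  assert (D2 := ff_x2 _ _ _ _ _ _ _ H t Ht).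
  unfold acc2. auto_derive.
  - repeat split; try (eexists; eassumption);
      repeat (apply Rmult_integral_contrapositive; split); lra.
  - replace (Derive (fun r : R => x1 r) t) with (v1 t)
      by (symmetry; exact (is_derive_unique _ _ _ D1)).
    replace (Derive (fun r : R => x2 r) t) with (v2 t)
      by (symmetry; exact (is_derive_unique _ _ _ D2)).
    rewrite Hv. field. lra.
Qed.

Lemma reversal_turning (m A th t : R) (x1 x2 v1 v2 : R -> R) :
  0 < m -> free_fall m A th x1 x2 v1 v2 -> 0 < t < th -> v2 t < 0 ->
  exists ts, 0 < ts < th /\ turning_time x2 ts.
Proof.
  intros Hm H Ht Hv.
  (* [c] ends the initial interval on which [v2 >= 0]; zeros where [v2] merely touches 0 are passed
     over. Of the three signs of [acc2] at [c], only the negative one is compatible with this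
     choice. *)
  destruct (first_failure (fun r => 0 <= v2 r) t) as [c [Hc [Hpos Hfail]]].
  - generalize (ff_v2_0 _ _ _ _ _ _ _ H). apply filter_imp. intros; lra.
  - lra.
  - lra.
  - assert (Hcth : 0 < c < th) by lra.
    assert (D := ff_v2 _ _ _ _ _ _ _ H c Hcth).
    assert (Ho := ff_order _ _ _ _ _ _ _ H c Hcth).
    assert (Hv0 : v2 c = 0).
    { assert (0 <= v2 c) by (apply (derive_closure 0 v2 c _ 0 D); [lra|exact Hpos]).
      apply Rle_antisym; [|assumption]. apply Rnot_lt_le. intro Hlt.
      apply Hfail. generalize (is_derive_locally_gt v2 c _ 0 D Hlt).
      apply filter_imp. intros; lra. }
    destruct (Rtotal_order (acc2 m (x1 c) (x2 c)) 0) as [Hneg|[Hz|Hgt]].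
    + exists c. split; [exact Hcth|]. split.
      { rewrite <- Hv0. now apply (ff_x2 _ _ _ _ _ _ _ H). }
      destruct (is_derive_pos_sign (fun r => - v2 r) c _ (is_derive_opp v2 c _ D))
        as [e [He [Hl Hr]]].
      { unfold opp; simpl. lra. }
      set (e' := Rmin e (Rmin c (th - c))).
      assert (He' : 0 < e') by (repeat apply Rmin_pos; lra).
      assert (e' <= e) by apply Rmin_l.
      assert (e' <= Rmin c (th - c)) by apply Rmin_r.
      assert (Rmin c (th - c) <= c) by apply Rmin_l.
      assert (Rmin c (th - c) <= th - c) by apply Rmin_r.
      exists (c - e' / 2), (c + e' / 2). split; [lra|]. left.
      split; intros r Hr'; exists (v2 r); (split; [apply (ff_x2 _ _ _ _ _ _ _ H); lra|]).
      * specialize (Hl r ltac:(lra)). lra.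
      * specialize (Hr r ltac:(lra)). lra.
    + exfalso. apply Hfail.
      assert (Hd : 0 < 2 * v1 c * (/ (x1 c + x2 c) ^ 3 - / (x1 c - x2 c) ^ 3)).
      { assert (v1 c < 0) by (apply (free_fall_v1_neg _ _ _ _ _ _ _ Hm H); lra).
        assert (/ (x1 c + x2 c) ^ 3 < / (x1 c - x2 c) ^ 3); [|nra].
        apply Rinv_lt_contravar.
        - apply Rmult_lt_0_compat; apply pow_lt; lra.
        - simpl. rewrite !Rmult_1_r. apply Rmult_gt_0_lt_compat; nra. }
      destruct (is_derive_pos_sign _ c _ (acc2_derive _ _ _ _ _ _ _ _ H Hcth Hv0) Hd)
        as [e [He [_ Hr]]].
      assert (Hm' : 0 < Rmin e (Rmin c (th - c))) by (repeat apply Rmin_pos; lra).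
      assert (L1 := Rmin_l e (Rmin c (th - c))).
      assert (L2 := Rmin_r e (Rmin c (th - c))).
      assert (L3 := Rmin_l c (th - c)). assert (L4 := Rmin_r c (th - c)).
      apply locally_R. exists (Rmin e (Rmin c (th - c))). split; [exact Hm'|].
      intros r Hr'. destruct (Rlt_or_le r c) as [Hlt|Hle]; [apply Hpos; lra|].
      enough (0 * (r - c) <= v2 r - v2 c) by lra.
      apply (derive_ge v2 (fun q => acc2 m (x1 q) (x2 q))); [exact Hle|].
      intros q Hq. split; [apply (ff_v2 _ _ _ _ _ _ _ H); lra|].
      destruct (Req_dec q c) as [->|Hne]; [lra|].
      rewrite <- Hz. left. apply Hr. lra.
    + exfalso.
      destruct (is_derive_pos_sign v2 c _ D Hgt) as [e [He [Hl _]]].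
      assert (Hm' : 0 < Rmin e c) by (apply Rmin_pos; lra).
      assert (L1 := Rmin_l e c). assert (L2 := Rmin_r e c).
      generalize (Hl (c - Rmin e c / 2) ltac:(lra)) (Hpos (c - Rmin e c / 2) ltac:(lra)).
      lra.
Qed.

(** Without a reversal, as long as the outer body stays far away, the inner energy is at most
    [- 1 / 2]. This confines [x2] to [m ^ 2] and so gives [acc2] a negative upper bound. A velocity
    that remains nonnegative under this deceleration must have been so large before that [x2] would
    exceed [m ^ 2]. *)
Lemma reversal_large (m : R) :
  0 < m -> exists A1, 0 < A1 /\
    forall A th x1 x2 v1 v2, A1 <= A -> free_fall m A th x1 x2 v1 v2 ->
      exists t, 0 < t < th /\ v2 t < 0.
Proof.
  intros Hm.
  (* During a time [w] of deceleration at least [1 / (8 * m ^ 3)], with nonnegative final velocity,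
     [x2] gains at least [w ^ 2 / (16 * m ^ 3)], which exceeds [m ^ 2]. The additional [1 / 2] keeps
     this interval away from the collision at 0. *)
  set (w := 1 + 16 * m ^ 5). set (T := w + 1 / 2).
  assert (Hm5 : 0 < m ^ 5) by (apply pow_lt; lra).
  assert (Hm3 : 0 < m ^ 3) by (apply pow_lt; lra).
  assert (Hm2 : 0 < m ^ 2) by (apply pow_lt; lra).
  (* [3 + 24 * m] makes the outer potential at most [1 / 2]; [8 * m ^ 2] puts [m ^ 2] below [A / 4];
     [128 * m ^ 3] lets the outer pull cancel at most half of the inner attraction; the last summand
     limits the fall of [x1] up to time [2 * T] to [A / 4]. *)
  exists (3 + 24 * m + 8 * m ^ 2 + 128 * m ^ 3 + 16 * (1 + 20 * m) * T ^ 2).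
  assert (HT : 1 < w /\ 1 < T) by (unfold T, w; lra).
  assert (HT2 : 0 < (1 + 20 * m) * T ^ 2) by (apply Rmult_lt_0_compat; nra).
  split; [lra|].
  intros A th x1 x2 v1 v2 HA H. apply NNPP. intro Hno.
  assert (Hv : forall t, 0 < t < th -> 0 <= v2 t).
  { intros t Ht. apply Rnot_lt_le. intro. apply Hno. now exists t. }
  clear Hno.
  assert (HA2 : A <= A ^ 2) by nra.
  set (P := fun t => A / 2 < x1 t /\ x2 t < A / 4).
  assert (B : forall t, 0 < t < th -> P t ->
    x2 t <= m ^ 2 /\ acc2 m (x1 t) (x2 t) <= - (1 / (8 * m ^ 3)) /\
    - ((1 + 20 * m) / A ^ 2) <= acc1 m (x1 t) (x2 t)).
  { intros t Ht [P1 P2]. assert (Ho := ff_order _ _ _ _ _ _ _ H t Ht).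
    assert (I1 : / x1 t <= / (A / 2)) by (apply Rinv_le_contravar; lra).
    assert (I2 : / (x1 t + x2 t) <= / (A / 2)) by (apply Rinv_le_contravar; lra).
    assert (I3 : / (x1 t - x2 t) <= / (A / 4)) by (apply Rinv_le_contravar; lra).
    assert (J1 : / x1 t ^ 2 <= / (A / 2) ^ 2) by (apply inv_sq_le; lra).
    assert (J2 : / (x1 t + x2 t) ^ 2 <= / (A / 2) ^ 2) by (apply inv_sq_le; lra).
    assert (J3 : / (x1 t - x2 t) ^ 2 <= / (A / 4) ^ 2) by (apply inv_sq_le; lra).
    assert (J2' : 0 < / (x1 t + x2 t) ^ 2) by (apply Rinv_0_lt_compat, pow_lt; lra).
    replace (/ (A / 2)) with (2 * / A) in I1, I2 by (field; lra).
    replace (/ (A / 4)) with (4 * / A) in I3 by (field; lra).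
    replace (/ (A / 2) ^ 2) with (4 * / A ^ 2) in J1, J2 by (field; lra).
    replace (/ (A / 4) ^ 2) with (16 * / A ^ 2) in J3 by (field; lra).
    assert (X : x2 t <= m ^ 2).
    { assert (E := ff_energy _ _ _ _ _ _ _ H t Ht).
      unfold inner_energy, outer_potential in E.
      assert (K : (1 + 12 * m) * / A <= 1 / 2).
      { apply Rmult_le_reg_r with A; [lra|]. rewrite Rmult_assoc, Rinv_l by lra. lra. }
      assert (1 / 2 <= m ^ 2 / 2 * / x2 t).
      { assert (0 <= v1 t ^ 2) by apply pow2_ge_0.
        assert (0 <= m * v2 t ^ 2) by (apply Rmult_le_pos; [lra|apply pow2_ge_0]).
        nra. }
      assert (E2 : m ^ 2 / 2 = m ^ 2 / 2 * / x2 t * x2 t) by (field; lra).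
      nra. }
    split; [exact X|]. unfold acc1, acc2. split.
    - assert (J4 : / (m ^ 2) ^ 2 <= / x2 t ^ 2) by (apply inv_sq_le; lra).
      replace (1 / (8 * m ^ 3)) with (1 / 8 * / m ^ 3) by (field; lra).
      assert (m / 4 * / (m ^ 2) ^ 2 = 1 / 4 * / m ^ 3) as E1 by (field; lra).
      assert (16 * / A ^ 2 <= 1 / 8 * / m ^ 3).
      { assert (/ A ^ 2 <= / (128 * m ^ 3)) by (apply Rinv_le_contravar; nra).
        replace (1 / 8 * / m ^ 3) with (16 * / (128 * m ^ 3)) by (field; lra). lra. }
      assert (m / 4 * / (m ^ 2) ^ 2 <= m / 4 * / x2 t ^ 2)
        by (apply Rmult_le_compat_l; lra).
      lra.
    - unfold Rdiv. nra. }
  assert (R0 : forall t, 0 < t < Rmin th (2 * T) -> P t).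
  { apply real_induction.
    - generalize (filter_and (F := at_right 0) _ _
        (filterlim_near _ _ (A / 2) (ff_x1_0 _ _ _ _ _ _ _ H) ltac:(lra))
        (filterlim_near _ _ (A / 4) (ff_x2_0 _ _ _ _ _ _ _ H) ltac:(lra))).
      apply filter_imp. unfold P. intros; lra.
    - intros c Hc HP.
      assert (L1 := Rmin_l th (2 * T)). assert (L2 := Rmin_r th (2 * T)).
      assert (D1 := ff_x1 _ _ _ _ _ _ _ H c ltac:(lra)).
      assert (D2 := ff_x2 _ _ _ _ _ _ _ H c ltac:(lra)).
      set (b := (1 + 20 * m) / A ^ 2) in B.
      assert (Hb : 0 < b) by (apply Rdiv_lt_0_compat; nra).
      assert (HbT : 4 * b * T ^ 2 <= A / 4).
      { replace (4 * b * T ^ 2) with (4 * ((1 + 20 * m) * T ^ 2) * / A ^ 2)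
          by (unfold b; field; lra).
        apply Rmult_le_reg_r with (A ^ 2); [nra|].
        rewrite Rmult_assoc, Rinv_l by nra. nra. }
      assert (V : forall t, 0 < t < c -> - (b * (2 * T)) <= v1 t).
      { intros t Ht.
        assert (- v1 t <= - 0 + b * t).
        { apply (derive_le_lim0 (fun r => - v1 r) (fun r => - acc1 m (x1 r) (x2 r)));
            [|lra| |lra].
          - apply filterlim_comp with (2 := filterlim_opp 0).
            apply (ff_v1_0 _ _ _ _ _ _ _ H).
          - intros r Hr. split.
            + apply (is_derive_opp v1 r), (ff_v1 _ _ _ _ _ _ _ H); lra.
            + destruct (B r ltac:(lra) (HP r ltac:(lra))) as [_ [_ B3]]. lra. }
        nra. }
      assert (X1 : A / 2 < x1 c).
      { enough (A - A / 4 <= x1 c) by lra.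
        apply (derive_closure 0 x1 c _ _ D1); [lra|]. intros t Ht.
        assert (- x1 t <= - A + b * (2 * T) * t).
        { apply (derive_le_lim0 (fun r => - x1 r) (fun r => - v1 r)); [|lra| |nra].
          - apply filterlim_comp with (2 := filterlim_opp A).
            apply (ff_x1_0 _ _ _ _ _ _ _ H).
          - intros r Hr. split.
            + apply (is_derive_opp x1 r), (ff_x1 _ _ _ _ _ _ _ H); lra.
            + specialize (V r ltac:(lra)). lra. }
        assert (b * (2 * T) * t <= b * (2 * T) * (2 * T)) by (apply Rmult_le_compat_l; nra).
        nra. }
      assert (X2 : x2 c < A / 4).
      { enough (- m ^ 2 <= - x2 c) by lra.
        apply (derive_closure 0 (fun r => - x2 r) c _ _ (is_derive_opp x2 c _ D2)); [lra|].
        intros t Ht. destruct (B t ltac:(lra) (HP t Ht)) as [B1 _]. lra. }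
      apply filter_and.
      + exact (is_derive_locally_gt x1 c _ _ D1 X1).
      + exact (is_derive_locally_lt x2 c _ _ D2 X2). }
  assert (Hth := ff_th _ _ _ _ _ _ _ H).
  (* A collision before [2 * T] is impossible: [x2] does not decrease and the gap exceeds
     [A / 4]. *)
  destruct (Rle_or_lt th (2 * T)) as [Hle|Hgt].
  - rewrite Rmin_left in R0 by lra.
    apply (free_fall_not_end _ _ _ (th / 2) (x2 (th / 2)) (A / 4) _ _ _ _ H); try lra.
    + apply (ff_order _ _ _ _ _ _ _ H); lra.
    + intros t Ht. split.
      * apply (free_fall_x2_mono _ _ _ th _ _ _ _ H); [lra|exact Hv|lra|lra].
      * destruct (R0 t ltac:(lra)). lra.
  - rewrite Rmin_right in R0 by lra.
    set (k := 1 / (8 * m ^ 3)) in B.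
    assert (Hk : 0 < k) by (apply Rdiv_lt_0_compat; lra).
    assert (V : forall t, 0 < t <= T -> k * (T - t) <= v2 t).
    { intros t Ht.
      assert (v2 T - v2 t <= - k * (T - t)).
      { apply (derive_le v2 (fun r => acc2 m (x1 r) (x2 r))); [lra|].
        intros r Hr. split; [apply (ff_v2 _ _ _ _ _ _ _ H); lra|].
        apply (B r); [lra|]. apply R0; lra. }
      generalize (Hv T ltac:(lra)). lra. }
    assert (G : 0 * (T - 1 / 2) <=
      (x2 T + k * (T - T) ^ 2 / 2) - (x2 (1 / 2) + k * (T - 1 / 2) ^ 2 / 2)).
    { apply (derive_ge (fun t => x2 t + k * (T - t) ^ 2 / 2)
               (fun t => v2 t - k * (T - t))); [lra|].
      intros r Hr. split; [|generalize (V r ltac:(lra)); lra].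
      assert (D := ff_x2 _ _ _ _ _ _ _ H r ltac:(lra)).
      auto_derive; [now exists (v2 r)|].
      replace (Derive (fun r : R => x2 r) r) with (v2 r)
        by (symmetry; exact (is_derive_unique _ _ _ D)). field. }
    assert (0 < x2 (1 / 2)) by (apply (ff_order _ _ _ _ _ _ _ H); lra).
    destruct (B T ltac:(lra) (R0 T ltac:(lra))) as [B1 _].
    replace (T - 1 / 2) with w in G by (unfold T; ring).
    assert (K : m ^ 2 < k * w ^ 2 / 2).
    { replace (m ^ 2) with (k * (16 * m ^ 5) / 2) by (unfold k; field; lra).
      assert (16 * m ^ 5 < w ^ 2) by (unfold w; nra). nra. }
    nra.
Qed.

(** * Monotone dependence on [A] *)

(** By convexity a negative slope at [t] would be negative at all earlier times, and [f] would have
    fallen from 0. This serves for [f = y2 - x2]: its slope is a difference of two velocities that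
    are infinite at 0, so the slope cannot be integrated from the start. *)
Lemma convex_nonneg_slope (f g dg : R -> R) (T : R) :
  filterlim f (at_right 0) (locally 0) ->
  (forall t, 0 < t < T -> 0 < f t /\ is_derive f t (g t) /\ is_derive g t (dg t) /\ 0 <= dg t) ->
  forall t, 0 < t < T -> 0 <= g t.
Proof.
  intros H0 H t Ht. apply Rnot_lt_le. intro Hneg.
  enough (f t <= 0) by (generalize (H t Ht); lra).
  apply (lim0_ge f 0 _ t H0); [lra|]. intros s Hs.
  enough (f t - f s <= 0 * (t - s)) by lra.
  apply (derive_le f g); [lra|]. intros r Hr. split; [apply H; lra|].
  enough (0 * (t - r) <= g t - g r) by lra.
  apply (derive_ge g dg); [lra|]. intros q Hq. split; apply H; lra.
Qed.

Lemma free_fall_compare_slopes (m A A' th th' T : R) (x1 x2 v1 v2 y1 y2 z1 z2 : R -> R) :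
  0 < m -> free_fall m A th x1 x2 v1 v2 -> free_fall m A' th' y1 y2 z1 z2 ->
  T <= th -> T <= th' ->
  (forall t, 0 < t < T -> y1 t < x1 t /\ x2 t < y2 t) ->
  forall t, 0 < t < T -> z1 t <= v1 t /\ v2 t <= z2 t.
Proof.
  intros Hm H H' HT HT' Hxy.
  assert (Hacc : forall t, 0 < t < T ->
    acc1 m (y1 t) (y2 t) < acc1 m (x1 t) (x2 t) /\
    acc2 m (x1 t) (x2 t) < acc2 m (y1 t) (y2 t)).
  { intros t Ht. destruct (Hxy t Ht) as [E1 E2].
    assert (Ho := ff_order _ _ _ _ _ _ _ H t ltac:(lra)).
    assert (Ho' := ff_order _ _ _ _ _ _ _ H' t ltac:(lra)).
    apply acc_cooperative; lra. }
  intros t Ht. split.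
  - enough (0 <= v1 t - z1 t) by lra.
    apply (derive_nonneg_lim0 (fun r => v1 r - z1 r)
             (fun r => acc1 m (x1 r) (x2 r) - acc1 m (y1 r) (y2 r))); [|lra|].
    + apply (filterlim_sub _ _ 0 0); [| |ring].
      * apply (ff_v1_0 _ _ _ _ _ _ _ H).
      * apply (ff_v1_0 _ _ _ _ _ _ _ H').
    + intros r Hr. split; [|generalize (Hacc r ltac:(lra)); lra].
      apply (is_derive_minus v1 z1).
      * apply (ff_v1 _ _ _ _ _ _ _ H); lra.
      * apply (ff_v1 _ _ _ _ _ _ _ H'); lra.
  - enough (0 <= z2 t - v2 t) by lra.
    apply (convex_nonneg_slope (fun r => y2 r - x2 r) (fun r => z2 r - v2 r)
             (fun r => acc2 m (y1 r) (y2 r) - acc2 m (x1 r) (x2 r)) T); [| |exact Ht].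
    + apply (filterlim_sub _ _ 0 0); [| |ring].
      * apply (ff_x2_0 _ _ _ _ _ _ _ H').
      * apply (ff_x2_0 _ _ _ _ _ _ _ H).
    + intros r Hr. split; [generalize (Hxy r Hr); lra|]. split; [|split].
      * apply (is_derive_minus y2 x2).
        -- apply (ff_x2 _ _ _ _ _ _ _ H'); lra.
        -- apply (ff_x2 _ _ _ _ _ _ _ H); lra.
      * apply (is_derive_minus z2 v2).
        -- apply (ff_v2 _ _ _ _ _ _ _ H'); lra.
        -- apply (ff_v2 _ _ _ _ _ _ _ H); lra.
      * generalize (Hacc r Hr); lra.
Qed.

(** Both values of [x2] start from 0 with infinite velocity, so only the limits of the inner
    energies tell them apart. *)
Lemma free_fall_compare_start (m A A' th th' : R) (x1 x2 v1 v2 y1 y2 z1 z2 : R -> R) :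
  0 < m -> 0 < A' < A ->
  free_fall m A th x1 x2 v1 v2 -> free_fall m A' th' y1 y2 z1 z2 ->
  at_right 0 (fun t => y1 t < x1 t /\ x2 t < y2 t).
Proof.
  intros Hm HA H H'.
  set (e := -1 + (1 / 2 + 4 * m) / A). set (e' := -1 + (1 / 2 + 4 * m) / A').
  assert (He : e < e').
  { unfold e, e', Rdiv.
    assert (/ A < / A') by (apply Rinv_lt_contravar; nra). nra. }
  assert (G : at_right 0 (fun t =>
    (y1 t < x1 t /\ inner_energy m (x2 t) (v2 t) < inner_energy m (y2 t) (z2 t)) /\
    (0 < v2 t /\ 0 < z2 t))).
  { apply filter_and; apply filter_and.
    - generalize (filter_and (F := at_right 0) _ _
        (filterlim_near _ _ ((A - A') / 2) (ff_x1_0 _ _ _ _ _ _ _ H) ltac:(lra))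
        (filterlim_near _ _ ((A - A') / 2) (ff_x1_0 _ _ _ _ _ _ _ H') ltac:(lra))).
      apply filter_imp. intros; lra.
    - generalize (filter_and (F := at_right 0) _ _
        (filterlim_near _ _ ((e' - e) / 2) (ff_inner_0 _ _ _ _ _ _ _ H) ltac:(lra))
        (filterlim_near _ _ ((e' - e) / 2) (ff_inner_0 _ _ _ _ _ _ _ H') ltac:(lra))).
      apply filter_imp. unfold e, e'. intros; lra.
    - apply (ff_v2_0 _ _ _ _ _ _ _ H).
    - apply (ff_v2_0 _ _ _ _ _ _ _ H'). }
  apply at_right0_iff in G. destruct G as [d [Hd G]].
  assert (Hth := ff_th _ _ _ _ _ _ _ H). assert (Hth' := ff_th _ _ _ _ _ _ _ H').
  apply at_right0_iff. exists (Rmin d (Rmin th th')).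
  assert (L1 := Rmin_l d (Rmin th th')). assert (L2 := Rmin_r d (Rmin th th')).
  assert (L3 := Rmin_l th th'). assert (L4 := Rmin_r th th').
  split; [repeat apply Rmin_pos; assumption|].
  intros t Ht. split; [apply G; lra|].
  (* By the energies, [y2 - x2] increases whenever it is not positive, so it
     could not have started from [0]. *)
  set (u := fun r => y2 r - x2 r).
  assert (Du : forall r, 0 < r <= t -> is_derive u r (z2 r - v2 r)).
  { intros r Hr. apply (is_derive_minus y2 x2).
    - apply (ff_x2 _ _ _ _ _ _ _ H'); lra.
    - apply (ff_x2 _ _ _ _ _ _ _ H); lra. }
  assert (Hup : forall r, 0 < r <= t -> u r <= 0 -> 0 < z2 r - v2 r).
  { intros r Hr Hu. destruct (G r ltac:(lra)) as [[_ G1] [G2 G3]].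
    assert (Ho := ff_order _ _ _ _ _ _ _ H r ltac:(lra)).
    assert (Ho' := ff_order _ _ _ _ _ _ _ H' r ltac:(lra)).
    unfold inner_energy in G1. unfold u in Hu.
    assert (/ x2 r <= / y2 r) by (apply Rinv_le_contravar; lra).
    assert (0 < m ^ 2) by nra.
    assert (m ^ 2 / 2 * / x2 r <= m ^ 2 / 2 * / y2 r) by (apply Rmult_le_compat_l; lra).
    assert (v2 r ^ 2 < z2 r ^ 2) by nra. nra. }
  assert (U0 : filterlim u (at_right 0) (locally 0)).
  { apply (filterlim_sub _ _ 0 0); [| |ring].
    - apply (ff_x2_0 _ _ _ _ _ _ _ H').
    - apply (ff_x2_0 _ _ _ _ _ _ _ H). }
  enough (0 < u t) by (unfold u in *; lra).
  apply Rnot_le_lt. intro Hut.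
  (* Continuation backwards from [t], written in [r = t - time] because [real_induction] moves to
     the right from 0. *)
  assert (Hback : forall r, 0 < r < t -> u (t - r) < u t).
  { apply real_induction.
    - destruct (is_derive_pos_sign u t _ (Du t ltac:(lra)) (Hup t ltac:(lra) Hut))
        as [q [Hq [Hl _]]].
      apply at_right0_iff. exists q. split; [exact Hq|]. intros r Hr. apply Hl. lra.
    - intros c Hc HP.
      assert (D : is_derive (fun r => u (t - r)) c (- (z2 (t - c) - v2 (t - c)))).
      { evar_last.
        - apply (is_derive_comp u (fun r => t - r) c); [apply Du; lra|].
          auto_derive; [trivial|reflexivity].
        - unfold scal, mult, one; simpl. unfold mult; simpl. ring. }
      apply (is_derive_locally_lt (fun r => u (t - r)) c _ _ D).
      assert (Hle : u (t - c) <= u t).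
      { enough (- u t <= - u (t - c)) by lra.
        apply (derive_closure 0 (fun r => - u (t - r)) c _ _ (is_derive_opp _ c _ D)); [lra|].
        intros r Hr. generalize (HP r Hr). lra. }
      assert (Hz := Hup (t - c) ltac:(lra) ltac:(lra)).
      destruct (is_derive_pos_sign u (t - c) _ (Du (t - c) ltac:(lra)) Hz)
        as [q [Hq [_ Hr]]].
      assert (Hmn : 0 < Rmin q c) by (apply Rmin_pos; lra).
      assert (M1 := Rmin_l q c). assert (M2 := Rmin_r q c).
      specialize (Hr (t - c + Rmin q c / 2) ltac:(lra)).
      specialize (HP (c - Rmin q c / 2) ltac:(lra)).
      replace (t - (c - Rmin q c / 2)) with (t - c + Rmin q c / 2) in HP by ring.
      lra. }
  assert (Hs : u (t / 2) < u t).
  { specialize (Hback (t / 2) ltac:(lra)).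
    now replace (t - t / 2) with (t / 2) in Hback by field. }
  enough (0 <= u (t / 2)) by lra.
  apply (lim0_le u 0 _ (t / 2) U0); [lra|].
  intros s Hs'.
  enough (0 * (t / 2 - s) <= u (t / 2) - u s) by lra.
  apply (derive_ge u (fun r => z2 r - v2 r)); [lra|].
  intros r Hr. split; [apply Du; lra|]. left. apply Hup; [lra|].
  specialize (Hback (t - r) ltac:(lra)).
  replace (t - (t - r)) with r in Hback by ring. lra.
Qed.

(** While the positions are ordered, the velocity differences have a sign, so the position
    differences do not shrink and the order cannot be lost. The quantitative bound [A - A'] later
    keeps the gap of the wider motion away from 0. *)
Lemma free_fall_compare (m A A' th th' : R) (x1 x2 v1 v2 y1 y2 z1 z2 : R -> R) :
  0 < m -> 0 < A' < A ->
  free_fall m A th x1 x2 v1 v2 -> free_fall m A' th' y1 y2 z1 z2 ->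
  forall t, 0 < t < Rmin th th' ->
    (A - A' <= x1 t - y1 t /\ x2 t < y2 t) /\ (z1 t <= v1 t /\ v2 t <= z2 t).
Proof.
  intros Hm HA H H'.
  assert (L1 := Rmin_l th th'). assert (L2 := Rmin_r th th').
  set (T := Rmin th th') in *.
  assert (Dw : forall r, 0 < r < T -> is_derive (fun t => x1 t - y1 t) r (v1 r - z1 r)).
  { intros r Hr. apply (is_derive_minus x1 y1).
    - apply (ff_x1 _ _ _ _ _ _ _ H); lra.
    - apply (ff_x1 _ _ _ _ _ _ _ H'); lra. }
  assert (Du : forall r, 0 < r < T -> is_derive (fun t => y2 t - x2 t) r (z2 r - v2 r)).
  { intros r Hr. apply (is_derive_minus y2 x2).
    - apply (ff_x2 _ _ _ _ _ _ _ H'); lra.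
    - apply (ff_x2 _ _ _ _ _ _ _ H); lra. }
  assert (Hxy : forall t, 0 < t < T -> y1 t < x1 t /\ x2 t < y2 t).
  { apply real_induction.
    - exact (free_fall_compare_start _ _ _ _ _ _ _ _ _ _ _ _ _ Hm HA H H').
    - intros c Hc HP.
      assert (S := free_fall_compare_slopes _ _ _ _ _ c _ _ _ _ _ _ _ _ Hm H H'
                     ltac:(lra) ltac:(lra) HP).
      destruct (HP (c / 2) ltac:(lra)) as [P1 P2].
      assert (C1 : x1 (c / 2) - y1 (c / 2) <= x1 c - y1 c).
      { assert (Dc := Dw c Hc).
        assert (Hv : 0 <= v1 c - z1 c).
        { apply (derive_closure 0 (fun r => v1 r - z1 r) c
            (acc1 m (x1 c) (x2 c) - acc1 m (y1 c) (y2 c))); [|lra|].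
          - apply (is_derive_minus v1 z1).
            + apply (ff_v1 _ _ _ _ _ _ _ H); lra.
            + apply (ff_v1 _ _ _ _ _ _ _ H'); lra.
          - intros t Ht. generalize (S t Ht); lra. }
        enough (0 * (c - c / 2) <= (x1 c - y1 c) - (x1 (c / 2) - y1 (c / 2))) by lra.
        apply (derive_ge (fun r => x1 r - y1 r) (fun r => v1 r - z1 r)); [lra|].
        intros r Hr. split; [apply Dw; lra|].
        destruct (Req_dec r c) as [->|]; [exact Hv|]. generalize (S r ltac:(lra)); lra. }
      assert (C2 : y2 (c / 2) - x2 (c / 2) <= y2 c - x2 c).
      { assert (Hv : 0 <= z2 c - v2 c).
        { apply (derive_closure 0 (fun r => z2 r - v2 r) c
            (acc2 m (y1 c) (y2 c) - acc2 m (x1 c) (x2 c))); [|lra|].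
          - apply (is_derive_minus z2 v2).
            + apply (ff_v2 _ _ _ _ _ _ _ H'); lra.
            + apply (ff_v2 _ _ _ _ _ _ _ H); lra.
          - intros t Ht. generalize (S t Ht); lra. }
        enough (0 * (c - c / 2) <= (y2 c - x2 c) - (y2 (c / 2) - x2 (c / 2))) by lra.
        apply (derive_ge (fun r => y2 r - x2 r) (fun r => z2 r - v2 r)); [lra|].
        intros r Hr. split; [apply Du; lra|].
        destruct (Req_dec r c) as [->|]; [exact Hv|]. generalize (S r ltac:(lra)); lra. }
      generalize (filter_and (F := locally c) _ _
        (is_derive_locally_gt _ c _ 0 (Dw c Hc) ltac:(lra))
        (is_derive_locally_gt _ c _ 0 (Du c Hc) ltac:(lra))).
      apply filter_imp. intros t [E1 E2]. lra. }
  assert (S := free_fall_compare_slopes _ _ _ _ _ T _ _ _ _ _ _ _ _ Hm H H'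
                 ltac:(lra) ltac:(lra) Hxy).
  intros t Ht. split; [|exact (S t Ht)]. split; [|apply Hxy, Ht].
  apply (derive_nonneg_lim0 (fun r => x1 r - y1 r) (fun r => v1 r - z1 r)); [|lra|].
  - apply (filterlim_sub _ _ A A'); [| |ring].
    + apply (ff_x1_0 _ _ _ _ _ _ _ H).
    + apply (ff_x1_0 _ _ _ _ _ _ _ H').
  - intros r Hr. split; [apply Dw; lra|]. generalize (S r ltac:(lra)); lra.
Qed.

Lemma no_reversal_downward (m A A' th th' : R) (x1 x2 v1 v2 y1 y2 z1 z2 : R -> R) :
  0 < m -> 0 < A' < A ->
  free_fall m A th x1 x2 v1 v2 -> free_fall m A' th' y1 y2 z1 z2 ->
  (forall t, 0 < t < th -> 0 <= v2 t) ->
  forall t, 0 < t < th' -> 0 <= z2 t.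
Proof.
  intros Hm HA H H' Hv.
  assert (C := free_fall_compare _ _ _ _ _ _ _ _ _ _ _ _ _ Hm HA H H').
  assert (Hth := ff_th _ _ _ _ _ _ _ H).
  (* The motion from [A] cannot collide first: its gap exceeds [A - A'] while the other motion
     lasts, and its [x2] does not decrease. *)
  assert (Hle : th' <= th).
  { apply Rnot_lt_le. intro Hlt. rewrite Rmin_left in C by lra.
    apply (free_fall_not_end _ _ _ (th / 2) (x2 (th / 2)) (A - A') _ _ _ _ H); try lra.
    - apply (ff_order _ _ _ _ _ _ _ H); lra.
    - intros t Ht. split.
      + apply (free_fall_x2_mono _ _ _ th _ _ _ _ H); [lra|exact Hv|lra|lra].
      + assert (Ho := ff_order _ _ _ _ _ _ _ H' t ltac:(lra)).
        generalize (C t ltac:(lra)). lra. }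
  rewrite Rmin_right in C by lra.
  intros t Ht. generalize (C t Ht) (Hv t ltac:(lra)). lra.
Qed.

(** * Persistence of a reversal *)

Lemma double_product_le (p q k z : R) :
  0 <= k -> Rabs q <= k * z -> 2 * p * q <= k * (p ^ 2 + z ^ 2).
Proof.
  intros Hk Hq.
  assert (H1 : p * q <= Rabs p * Rabs q) by (rewrite <- Rabs_mult; apply Rle_abs).
  assert (H2 : Rabs p * Rabs q <= Rabs p * (k * z))
    by (apply Rmult_le_compat_l; [apply Rabs_pos | exact Hq]).
  assert (H3 : p ^ 2 = Rabs p ^ 2) by (symmetry; apply pow2_abs).
  rewrite H3. assert (0 <= k * (Rabs p - z) ^ 2); [|nra].
  apply Rmult_le_pos; [exact Hk | apply pow2_ge_0].
Qed.

Lemma sum_abs_sq_le (u w : R) : (Rabs u + Rabs w) ^ 2 <= 2 * (u ^ 2 + w ^ 2).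
Proof.
  rewrite <- (pow2_abs u), <- (pow2_abs w).
  generalize (pow2_ge_0 (Rabs u - Rabs w)). nra.
Qed.

Lemma inv_diff_opposite (x y : R) : 0 < x -> 0 < y -> (y - x) * (/ y - / x) <= 0.
Proof.
  intros Hx Hy.
  replace ((y - x) * (/ y - / x)) with (- ((y - x) ^ 2 * (/ x * / y))) by (field; lra).
  assert (0 < / x) by now apply Rinv_0_lt_compat.
  assert (0 < / y) by now apply Rinv_0_lt_compat.
  assert (0 <= (y - x) ^ 2 * (/ x * / y)); [|lra].
  apply Rmult_le_pos; [apply pow2_ge_0 | nra].
Qed.

(* The repulsive sign of the singular term makes the energy relation a bound on
   [(y2 - x2) (z2 - v2)] that is uniform up to the collision. *)
Lemma inner_energy_contracts (m x2 y2 v2 z2 W z P : R) :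
  0 < m -> 0 < x2 -> 0 < y2 -> 1 <= v2 -> 0 <= z2 -> 0 <= P ->
  Rabs (inner_energy m y2 z2 - inner_energy m x2 v2) <= 3 * Rabs W + P * z ->
  2 * (y2 - x2) * (z2 - v2)
    <= (3 * ((y2 - x2) ^ 2 + W ^ 2) + P * ((y2 - x2) ^ 2 + z ^ 2)) / m.
Proof.
  intros Hm Hx Hy Hv Hz HP He.
  set (u := y2 - x2) in *. set (e := inner_energy m y2 z2 - inner_energy m x2 v2) in *.
  assert (B : 2 * u * e <= 3 * (u ^ 2 + W ^ 2) + P * (u ^ 2 + z ^ 2)).
  { assert (A1 := double_product_le (Rabs u) (Rabs W) 1 (Rabs W) ltac:(lra)).
    rewrite Rabs_Rabsolu, !pow2_abs in A1. specialize (A1 ltac:(lra)).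
    assert (A2 := double_product_le (Rabs u) (P * z) P (Rabs z) HP).
    rewrite !pow2_abs, Rabs_mult, (Rabs_pos_eq P) in A2 by exact HP.
    specialize (A2 ltac:(lra)).
    assert (A3 : u * e <= Rabs u * (3 * Rabs W + P * z)).
    { apply Rle_trans with (Rabs u * Rabs e).
      - rewrite <- Rabs_mult. apply Rle_abs.
      - apply Rmult_le_compat_l; [apply Rabs_pos|exact He]. }
    lra. }
  assert (E : m * (2 * u * (z2 - v2) * (z2 + v2))
              = m ^ 2 * (u * (/ y2 - / x2)) + 2 * u * e).
  { unfold e, inner_energy. field. lra. }
  assert (N := inv_diff_opposite x2 y2 Hx Hy). fold u in N.
  assert (Hm2 : 0 < m ^ 2) by nra.
  set (X := 2 * u * (z2 - v2)) in *.
  set (Y := 3 * (u ^ 2 + W ^ 2) + P * (u ^ 2 + z ^ 2)) in *.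
  assert (HY : 0 <= Y).
  { unfold Y. generalize (pow2_ge_0 u) (pow2_ge_0 W) (pow2_ge_0 z). nra. }
  assert (EY : m * (X * (z2 + v2)) <= Y) by nra.
  apply Rmult_le_reg_l with m; [exact Hm|].
  replace (m * (Y / m)) with Y by (field; lra).
  destruct (Rle_or_lt X 0) as [HX|HX]; [nra|].
  apply Rle_trans with (2 := EY). apply Rmult_le_compat_l; [lra|nra].
Qed.

(** Away from the collision the energies determine the velocity difference itself. This recovers it
    at the time when the estimate near the start, which does not track it, is handed over to the
    ordinary one. *)
Lemma inner_energy_velocity (m x2 y2 v2 z2 W z P b : R) :
  0 < m -> 0 < b -> b <= x2 -> b <= y2 -> Rabs (y2 - x2) <= z ->
  1 <= v2 -> 0 <= z2 -> 0 <= P ->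
  Rabs (inner_energy m y2 z2 - inner_energy m x2 v2) <= 3 * Rabs W + P * z ->
  Rabs (z2 - v2) <= 3 / m * Rabs W + (m / 2 / b ^ 2 + P / m) * z.
Proof.
  intros Hm Hb Hx Hy Hu Hv Hz HP He.
  set (e := inner_energy m y2 z2 - inner_energy m x2 v2) in *.
  assert (Hz0 : 0 <= z) by (generalize (Rabs_pos (y2 - x2)); lra).
  assert (A1 := Rle_abs (y2 - x2)). assert (A2 := Rle_abs (- (y2 - x2))).
  rewrite Rabs_Ropp in A2.
  assert (I1 := inv_diff_le b z y2 x2 Hb Hy Hx ltac:(lra) Hz0).
  assert (I2 := inv_diff_le b z x2 y2 Hb Hx Hy ltac:(lra) Hz0).
  assert (I : Rabs (/ y2 - / x2) <= z / b ^ 2) by (apply Rabs_le; lra).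
  assert (E : (z2 - v2) * (z2 + v2) = m / 2 * (/ y2 - / x2) + / m * e).
  { unfold e, inner_energy. field. lra. }
  assert (Hmi : 0 < / m) by now apply Rinv_0_lt_compat.
  apply Rle_trans with (Rabs ((z2 - v2) * (z2 + v2))).
  - rewrite Rabs_mult, (Rabs_pos_eq (z2 + v2)) by lra.
    generalize (Rabs_pos (z2 - v2)). nra.
  - rewrite E. apply Rle_trans with (1 := Rabs_triang _ _).
    rewrite !Rabs_mult, (Rabs_pos_eq (m / 2)), (Rabs_pos_eq (/ m)) by lra.
    replace (3 / m * Rabs W + (m / 2 / b ^ 2 + P / m) * z)
      with (m / 2 * (z / b ^ 2) + / m * (3 * Rabs W + P * z)) by (field; lra).
    apply Rplus_le_compat; apply Rmult_le_compat_l; lra.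
Qed.

Lemma free_fall_start_bounds (m A th : R) (x1 x2 v1 v2 : R -> R) :
  0 < m -> 0 < A -> free_fall m A th x1 x2 v1 v2 ->
  at_right 0 (fun t => (1 <= v2 t /\ Rabs (v1 t) <= 1) /\ A / 2 <= x1 t - x2 t).
Proof.
  intros Hm HA H.
  set (e0 := -1 + (1 / 2 + 4 * m) / A).
  assert (Ha := Rabs_pos (e0 - 1)). assert (Ha' := Rle_abs (- (e0 - 1))).
  rewrite Rabs_Ropp in Ha'.
  (* For [x2 < q] the potential term exceeds [m + Rabs (e0 - 1)]; with inner energy above [e0 - 1]
     this forces [v2 ^ 2 > 1]. *)
  set (q := m ^ 2 / 2 * / (m + Rabs (e0 - 1))).
  assert (Hq : 0 < q).
  { apply Rmult_lt_0_compat; [nra|]. apply Rinv_0_lt_compat; lra. }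
  assert (G : at_right 0 (fun t => ((A - A / 4 < x1 t < A + A / 4 /\ 0 < v2 t) /\
    ((0 - A / 4 < x2 t < 0 + A / 4 /\ 0 - q < x2 t < 0 + q) /\
     e0 - 1 < inner_energy m (x2 t) (v2 t) < e0 + 1)) /\
    (0 - 1 < v1 t < 0 + 1 /\ 0 < t < th))).
  { apply filter_and; [apply filter_and; apply filter_and|apply filter_and].
    - apply (filterlim_near _ _ _ (ff_x1_0 _ _ _ _ _ _ _ H)); lra.
    - apply (ff_v2_0 _ _ _ _ _ _ _ H).
    - apply filter_and; apply (filterlim_near _ _ _ (ff_x2_0 _ _ _ _ _ _ _ H)); lra.
    - apply (filterlim_near _ _ 1 (ff_inner_0 _ _ _ _ _ _ _ H)); lra.
    - apply (filterlim_near _ _ 1 (ff_v1_0 _ _ _ _ _ _ _ H)); lra.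
    - apply at_right0_below, (ff_th _ _ _ _ _ _ _ H). }
  revert G. apply filter_imp.
  intros t [[[G1 G2] [[G3 G4] G5]] [G6 G7]].
  split; [split|lra]; [|apply Rabs_le; lra].
  assert (Ho := ff_order _ _ _ _ _ _ _ H t G7).
  assert (Hi : m + Rabs (e0 - 1) <= m ^ 2 / 2 * / x2 t).
  { apply Rmult_le_reg_r with (x2 t); [lra|].
    rewrite Rmult_assoc, Rinv_l by lra.
    assert (E : q * (m + Rabs (e0 - 1)) = m ^ 2 / 2) by (unfold q; field; lra).
    nra. }
  unfold inner_energy in G5.
  assert (Hv : m * 1 < m * v2 t ^ 2) by lra.
  apply Rmult_lt_reg_l in Hv; [nra|exact Hm].
Qed.

(** Up to a short time [e] the squared distance [D1] leaves out the velocity difference [U], whose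
    effect is bounded through the energies; from [e] on, [D2] includes it. A motion without reversal
    would then have to stay close to the given one up to [ts], where [v2] is negative. *)
Lemma reversal_open (m A th ts : R) (x1 x2 v1 v2 : R -> R) :
  0 < m -> 0 < A -> free_fall m A th x1 x2 v1 v2 -> 0 < ts < th -> v2 ts < 0 ->
  exists eta, 0 < eta /\ forall A' th' y1 y2 z1 z2,
    Rabs (A' - A) < eta -> free_fall m A' th' y1 y2 z1 z2 ->
    exists t, 0 < t < th' /\ z2 t < 0.
Proof.
  intros Hm HA H Hts Hvts.
  set (tau := (ts + th) / 2).
  assert (Htau : ts < tau < th) by (unfold tau; lra).
  assert (Hstart : exists e, 0 < e < ts /\
    forall t, 0 < t <= e -> (1 <= v2 t /\ Rabs (v1 t) <= 1) /\ A / 2 <= x1 t - x2 t).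
  { assert (G := free_fall_start_bounds _ _ _ _ _ _ _ Hm HA H).
    apply at_right0_iff in G. destruct G as [d [Hd G]].
    assert (Hmn : 0 < Rmin d ts) by (apply Rmin_pos; lra).
    assert (M1 := Rmin_l d ts). assert (M2 := Rmin_r d ts).
    exists (Rmin d ts / 2). split; [lra|]. intros t Ht. apply G. lra. }
  destruct Hstart as [e [He Hstart]].
  destruct (pos_lower_bound x2 e tau ltac:(lra)) as [b' [Hb' Hxb]].
  { intros t Ht. split; [exists (v2 t); apply (ff_x2 _ _ _ _ _ _ _ H); lra|].
    apply (ff_order _ _ _ _ _ _ _ H); lra. }
  destruct (pos_lower_bound (fun t => x1 t - x2 t) e tau ltac:(lra)) as [c' [Hc' Hxc]].
  { intros t Ht. split.
    - exists (v1 t - v2 t). apply (is_derive_minus x1 x2).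
      + apply (ff_x1 _ _ _ _ _ _ _ H); lra.
      + apply (ff_x2 _ _ _ _ _ _ _ H); lra.
    - generalize (ff_order _ _ _ _ _ _ _ H t ltac:(lra)). lra. }
  set (b := b' / 2).
  assert (Hb : 0 < b) by (unfold b; lra).
  (* Deviations up to [c] leave a gap of at least [c] and, after [e], keep [y2] above [b]. The bound
     1 gives [Rabs (W t) <= 1], which with [Rabs (v1 t) <= 1] yields the factor 3 in the energy
     estimate. *)
  assert (Hc0 : exists c, 0 < c /\ c <= A / 4 /\ c <= c' / 2 /\ c <= b /\ c <= 1).
  { exists (Rmin (Rmin (A / 4) (c' / 2)) (Rmin b 1)).
    assert (M1 := Rmin_l (Rmin (A / 4) (c' / 2)) (Rmin b 1)).
    assert (M2 := Rmin_r (Rmin (A / 4) (c' / 2)) (Rmin b 1)).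
    assert (M3 := Rmin_l (A / 4) (c' / 2)). assert (M4 := Rmin_r (A / 4) (c' / 2)).
    assert (M5 := Rmin_l b 1). assert (M6 := Rmin_r b 1).
    split; [repeat apply Rmin_pos; lra|]. lra. }
  destruct Hc0 as [c [Hc [Hc1 [Hc2 [Hc3 Hc4]]]]].
  assert (Hgap : forall t, 0 < t <= tau -> 2 * c <= x1 t - x2 t).
  { intros t Ht. destruct (Rle_or_lt t e).
    - destruct (Hstart t ltac:(lra)). lra.
    - generalize (Hxc t ltac:(lra)). lra. }
  set (P2 := (1 / 2 + 4 * m) / c ^ 2). set (P3 := (1 / 2 + 4 * m) / c ^ 3).
  set (P4 := m / 2 / b ^ 3 + 4 / c ^ 3). set (P5 := m / 2 / b ^ 2 + P2 / m).
  assert (HP2 : 0 < P2) by (apply Rdiv_lt_0_compat; [lra | apply pow_lt; lra]).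
  assert (HP3 : 0 < P3) by (apply Rdiv_lt_0_compat; [lra | apply pow_lt; lra]).
  assert (HP4 : 0 < P4)
    by (apply Rplus_lt_0_compat; repeat (apply Rdiv_lt_0_compat || apply pow_lt); lra).
  assert (HP5 : 0 < P5)
    by (apply Rplus_lt_0_compat; repeat (apply Rdiv_lt_0_compat || apply pow_lt); lra).
  (* [L1] and [L2] are the growth rates of [D1] before [e] and of [D2] after it; [Ce] bounds [U ^ 2]
     by [D1] at the handover. The factors 3 arise because [z ^ 2] plus one more square is at most
     three times the distance. *)
  set (L1 := (3 + 3 * P2) / m + 1 + 3 * P3).
  set (L2 := 2 + 3 * P3 + 3 * P4).
  set (Ce := 2 * (3 / m) ^ 2 + 4 * P5 ^ 2).
  assert (HL1 : 0 < L1).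
  { assert (0 < (3 + 3 * P2) / m) by (apply Rdiv_lt_0_compat; lra). unfold L1; lra. }
  assert (HL2 : 0 < L2) by (unfold L2; lra).
  assert (HCe : 0 < Ce).
  { assert (0 <= (3 / m) ^ 2) by apply pow2_ge_0.
    assert (0 < P5 ^ 2) by (apply pow_lt; lra). unfold Ce; lra. }
  set (K := (1 + Ce) * exp (L1 * e) * exp (L2 * tau)).
  assert (HE1 : 1 < exp (L1 * e)).
  { rewrite <- exp_0. apply exp_increasing. apply Rmult_lt_0_compat; lra. }
  assert (HE2 : 1 < exp (L2 * tau)).
  { rewrite <- exp_0. apply exp_increasing. apply Rmult_lt_0_compat; lra. }
  assert (HK0 : exp (L1 * e) <= (1 + Ce) * exp (L1 * e)) by nra.
  assert (HK1 : (1 + Ce) * exp (L1 * e) <= K).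
  { unfold K. rewrite <- (Rmult_1_r ((1 + Ce) * exp (L1 * e))) at 1.
    apply Rmult_le_compat_l; lra. }
  assert (HK2 : exp (L1 * e) <= K) by lra.
  assert (HK : 1 < K) by lra.
  assert (Heta : 0 < Rmin (c / 2) (- v2 ts)) by (apply Rmin_pos; lra).
  (* As [K > 1], this makes [K * (A - A') ^ 2] smaller than [c ^ 2 / 4], so the motions stay close,
     and smaller than [v2 ts ^ 2], so the reversal persists. *)
  exists (Rmin (c / 2) (- v2 ts) / K). split; [apply Rdiv_lt_0_compat; lra|].
  intros A' th' y1 y2 z1 z2 HA' H'.
  (* The assumption also makes the estimate uniform in [A']: [0 <= z2] holds up to the end, whereas
     the time during which [z2] is known to be positive depends on the perturbed motion. *)
  apply NNPP. intro Hno.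
  assert (Hz2 : forall t, 0 < t < th' -> 0 <= z2 t).
  { intros t Ht. apply Rnot_lt_le. intro. apply Hno. now exists t. }
  clear Hno.
  set (eta2 := (A - A') ^ 2).
  assert (Heta0 : 0 <= eta2) by apply pow2_ge_0.
  assert (HKeta : K * eta2 < c ^ 2 / 4 /\ K * eta2 < v2 ts ^ 2).
  { assert (M1 := Rmin_l (c / 2) (- v2 ts)). assert (M2 := Rmin_r (c / 2) (- v2 ts)).
    set (r := Rmin (c / 2) (- v2 ts)) in *. set (d := Rabs (A' - A)) in *.
    assert (Hd : 0 <= d) by apply Rabs_pos.
    assert (Ed : eta2 = d ^ 2) by (unfold eta2, d; rewrite pow2_abs; ring).
    assert (HKd : K * d < r).
    { replace r with (K * (r / K)) by (field; lra). apply Rmult_lt_compat_l; lra. }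
    assert (d <= K * d) by nra.
    assert (K * d ^ 2 <= (K * d) ^ 2).
    { replace ((K * d) ^ 2) with (K * (K * d ^ 2)) by ring.
      assert (0 <= K * d ^ 2) by (apply Rmult_le_pos; [lra|apply pow2_ge_0]). nra. }
    rewrite Ed. assert ((K * d) ^ 2 < r ^ 2) by nra.
    assert (r ^ 2 <= (c / 2) ^ 2) by nra. assert (r ^ 2 <= v2 ts ^ 2) by nra. lra. }
  assert (Hth' := ff_th _ _ _ _ _ _ _ H').
  set (T := Rmin tau th').
  assert (HT0 : 0 < T) by (apply Rmin_pos; lra).
  assert (HT1 : T <= tau) by apply Rmin_l.
  assert (HT2 : T <= th') by apply Rmin_r.
  set (u := fun t => y2 t - x2 t). set (w := fun t => y1 t - x1 t).
  set (U := fun t => z2 t - v2 t). set (W := fun t => z1 t - v1 t).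
  set (z := fun t => Rabs (u t) + Rabs (w t)).
  set (a1 := fun t => acc1 m (y1 t) (y2 t) - acc1 m (x1 t) (x2 t)).
  set (a2 := fun t => acc2 m (y1 t) (y2 t) - acc2 m (x1 t) (x2 t)).
  assert (Du : forall t, 0 < t < T -> is_derive u t (U t)).
  { intros t Ht. apply (is_derive_minus y2 x2).
    - apply (ff_x2 _ _ _ _ _ _ _ H'); lra.
    - apply (ff_x2 _ _ _ _ _ _ _ H); lra. }
  assert (Dw : forall t, 0 < t < T -> is_derive w t (W t)).
  { intros t Ht. apply (is_derive_minus y1 x1).
    - apply (ff_x1 _ _ _ _ _ _ _ H'); lra.
    - apply (ff_x1 _ _ _ _ _ _ _ H); lra. }
  assert (DU : forall t, 0 < t < T -> is_derive U t (a2 t)).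
  { intros t Ht. apply (is_derive_minus z2 v2).
    - apply (ff_v2 _ _ _ _ _ _ _ H'); lra.
    - apply (ff_v2 _ _ _ _ _ _ _ H); lra. }
  assert (DW : forall t, 0 < t < T -> is_derive W t (a1 t)).
  { intros t Ht. apply (is_derive_minus z1 v1).
    - apply (ff_v1 _ _ _ _ _ _ _ H'); lra.
    - apply (ff_v1 _ _ _ _ _ _ _ H); lra. }
  set (D1 := fun t => u t ^ 2 + w t ^ 2 + W t ^ 2).
  set (D2 := fun t => D1 t + U t ^ 2).
  set (dD1 := fun t => 2 * u t * U t + 2 * w t * W t + 2 * W t * a1 t).
  set (dD2 := fun t => dD1 t + 2 * U t * a2 t).
  assert (DD1 : forall t, 0 < t < T -> is_derive D1 t (dD1 t)).
  { intros t Ht.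
    exact (is_derive_plus _ _ t _ _
      (is_derive_plus _ _ t _ _ (is_derive_sq u t _ (Du t Ht)) (is_derive_sq w t _ (Dw t Ht)))
      (is_derive_sq W t _ (DW t Ht))). }
  assert (DD2 : forall t, 0 < t < T -> is_derive D2 t (dD2 t)).
  { intros t Ht.
    exact (is_derive_plus _ _ t _ _ (DD1 t Ht) (is_derive_sq U t _ (DU t Ht))). }
  assert (K0 : filterlim D1 (at_right 0) (locally eta2)).
  { apply (filterlim_add (fun t => u t ^ 2 + w t ^ 2) (fun t => W t ^ 2) (eta2) (0 ^ 2));
      [|apply filterlim_sq|ring].
    - apply (filterlim_add (fun t => u t ^ 2) (fun t => w t ^ 2) (0 ^ 2) ((A' - A) ^ 2));
        [apply filterlim_sq|apply filterlim_sq|unfold eta2; ring].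
      + apply (filterlim_sub y2 x2 0 0); [| |ring].
        * apply (ff_x2_0 _ _ _ _ _ _ _ H').
        * apply (ff_x2_0 _ _ _ _ _ _ _ H).
      + apply (filterlim_sub y1 x1 A' A); [| |ring].
        * apply (ff_x1_0 _ _ _ _ _ _ _ H').
        * apply (ff_x1_0 _ _ _ _ _ _ _ H).
    - apply (filterlim_sub z1 v1 0 0); [| |ring].
      + apply (ff_v1_0 _ _ _ _ _ _ _ H').
      + apply (ff_v1_0 _ _ _ _ _ _ _ H). }
  assert (Sq : forall t, z t ^ 2 <= 2 * D1 t /\ u t ^ 2 <= D1 t /\ W t ^ 2 <= D1 t /\
     0 <= D1 t /\ D1 t <= D2 t /\ U t ^ 2 + D1 t = D2 t /\ 2 * w t * W t <= D1 t).
  { intros t. assert (S := sum_abs_sq_le (u t) (w t)). fold (z t) in S.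
    unfold D2, D1.
    assert (Q1 := pow2_ge_0 (u t)). assert (Q2 := pow2_ge_0 (w t)).
    assert (Q3 := pow2_ge_0 (W t)). assert (Q4 := pow2_ge_0 (U t)).
    assert (Q5 := pow2_ge_0 (w t - W t)).
    repeat split; lra. }
  assert (Near : forall t, 0 < t < T -> D1 t <= c ^ 2 / 2 ->
    (z t <= c /\ Rabs (W t) <= 1) /\ (c <= y1 t - y2 t /\ (e <= t -> b <= y2 t))).
  { intros t Ht Hd. destruct (Sq t) as [S1 [_ [S3 _]]].
    assert (Z0 : 0 <= z t) by (apply Rplus_le_le_0_compat; apply Rabs_pos).
    assert (Zc : z t <= c) by (apply Rnot_lt_le; intro; nra).
    assert (Wc : Rabs (W t) <= 1).
    { rewrite <- (pow2_abs (W t)) in S3. generalize (Rabs_pos (W t)). intro.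
      apply Rnot_lt_le; intro; nra. }
    assert (V1 := Rle_abs (u t)). assert (V2 := Rle_abs (- u t)).
    assert (V3 := Rle_abs (w t)). assert (V4 := Rle_abs (- w t)).
    rewrite Rabs_Ropp in V2, V4. assert (G := Hgap t ltac:(lra)).
    unfold z in Zc. unfold u, w in *.
    split; [now split|]. split; [lra|]. intros Het.
    assert (X := Hxb t ltac:(lra)). unfold b in *. lra. }
  assert (Lip1 : forall t, 0 < t < T -> D1 t <= c ^ 2 / 2 ->
    2 * W t * a1 t <= 3 * P3 * D1 t /\
    (t <= e -> 2 * u t * U t <= (3 + 3 * P2) / m * D1 t) /\
    (t = e -> U t ^ 2 <= Ce * D1 t) /\
    (e <= t -> 2 * U t * a2 t <= 3 * P4 * D2 t)).
  { intros t Ht Hd. destruct (Near t Ht Hd) as [[N1 N2] [N3 N4]].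
    destruct (Sq t) as [S1 [S2 [S3 [S4 [S5 [S6 S7]]]]]].
    assert (Ho := ff_order _ _ _ _ _ _ _ H t ltac:(lra)).
    assert (Ho' := ff_order _ _ _ _ _ _ _ H' t ltac:(lra)).
    destruct (acc_lipschitz m c (x1 t) (x2 t) (y1 t) (y2 t) (z t) Hm Hc
                ltac:(lra) ltac:(lra) ltac:(generalize (Hgap t ltac:(lra)); lra) N3
                ltac:(apply Rle_refl)) as [B1 [B2 B3]].
    fold P2 in B1. fold P3 in B2. rewrite Rabs_minus_sym in B2. fold (a1 t) in B2.
    assert (Ev : t <= e ->
      (1 <= v2 t /\ 0 <= z2 t) /\
      Rabs (inner_energy m (y2 t) (z2 t) - inner_energy m (x2 t) (v2 t))
        <= 3 * Rabs (W t) + P2 * z t).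
    { intros Hte. destruct (Hstart t ltac:(lra)) as [[T1 T2] _].
      split; [split; [exact T1|apply Hz2; lra]|].
      rewrite (ff_energy _ _ _ _ _ _ _ H t) by lra.
      rewrite (ff_energy _ _ _ _ _ _ _ H' t) by lra.
      replace (-1 - z1 t ^ 2 + outer_potential m (y1 t) (y2 t) -
               (-1 - v1 t ^ 2 + outer_potential m (x1 t) (x2 t)))
        with (- (W t * (W t + 2 * v1 t)) +
              (outer_potential m (y1 t) (y2 t) - outer_potential m (x1 t) (x2 t)))
        by (unfold W; ring).
      apply Rle_trans with (1 := Rabs_triang _ _). rewrite Rabs_Ropp, Rabs_mult.
      assert (Rabs (W t + 2 * v1 t) <= 3).
      { apply Rle_trans with (1 := Rabs_triang _ _).
        rewrite Rabs_mult, (Rabs_pos_eq 2) by lra. lra. }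
      assert (Rabs (W t) * Rabs (W t + 2 * v1 t) <= Rabs (W t) * 3)
        by (apply Rmult_le_compat_l; [apply Rabs_pos|assumption]).
      lra. }
    split; [|split; [|split]].
    - assert (G := double_product_le (W t) (a1 t) P3 (z t) ltac:(lra) B2).
      assert (P3 * (W t ^ 2 + z t ^ 2) <= P3 * (3 * D1 t))
        by (apply Rmult_le_compat_l; lra). lra.
    - intros Hte. destruct (Ev Hte) as [[T1 T2] T3].
      assert (G := inner_energy_contracts m (x2 t) (y2 t) (v2 t) (z2 t) (W t) (z t) P2
        Hm ltac:(lra) ltac:(lra) T1 T2 ltac:(lra) T3).
      fold (u t) (U t) in G. apply Rle_trans with (1 := G).
      replace ((3 + 3 * P2) / m * D1 t) with ((3 * D1 t + P2 * (3 * D1 t)) / m)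
        by (field; lra).
      apply Rmult_le_compat_r; [left; now apply Rinv_0_lt_compat|].
      assert (u t ^ 2 + W t ^ 2 <= D1 t) by (unfold D1; generalize (pow2_ge_0 (w t)); lra).
      assert (P2 * (u t ^ 2 + z t ^ 2) <= P2 * (3 * D1 t))
        by (apply Rmult_le_compat_l; lra). lra.
    - intros Hte. destruct (Ev ltac:(lra)) as [[T1 T2] T3].
      assert (X := Hxb t ltac:(lra)).
      assert (G := inner_energy_velocity m (x2 t) (y2 t) (v2 t) (z2 t) (W t) (z t) P2 b
        Hm Hb ltac:(unfold b; lra) (N4 ltac:(lra))
        ltac:(unfold z; generalize (Rabs_pos (w t)); fold (u t); lra)
        T1 T2 ltac:(lra) T3).
      fold P5 (U t) in G.
      rewrite <- (pow2_abs (U t)). rewrite <- (pow2_abs (W t)) in S3.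
      set (p := 3 / m * Rabs (W t)) in *. set (q := P5 * z t) in *.
      assert (G1 : Rabs (U t) ^ 2 <= (p + q) ^ 2)
        by (apply pow_incr; split; [apply Rabs_pos|exact G]).
      assert (G2 : (p + q) ^ 2 <= 2 * p ^ 2 + 2 * q ^ 2)
        by (generalize (pow2_ge_0 (p - q)); nra).
      assert (G3 : p ^ 2 <= (3 / m) ^ 2 * D1 t).
      { unfold p. rewrite Rpow_mult_distr.
        apply Rmult_le_compat_l; [apply pow2_ge_0|exact S3]. }
      assert (G4 : q ^ 2 <= P5 ^ 2 * (2 * D1 t)).
      { unfold q. rewrite Rpow_mult_distr.
        apply Rmult_le_compat_l; [apply pow2_ge_0|exact S1]. }
      unfold Ce. lra.
    - intros Het. assert (X := Hxb t ltac:(lra)).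
      specialize (B3 b Hb ltac:(unfold b; lra) (N4 Het)). fold P4 (a2 t) in B3.
      assert (G := double_product_le (U t) (a2 t) P4 (z t) ltac:(lra) B3).
      assert (P4 * (U t ^ 2 + z t ^ 2) <= P4 * (3 * D2 t))
        by (apply Rmult_le_compat_l; lra). lra. }
  assert (Est : forall T0, T0 <= T -> (forall t, 0 < t < T0 -> D1 t < c ^ 2 / 2) ->
    forall t, 0 < t < T0 -> D1 t <= K * eta2 /\ (e <= t -> U t ^ 2 <= K * eta2)).
  { intros T0 HT0' Hz t Ht.
    assert (Ph1 : forall r, 0 < r <= t -> r <= e -> D1 r <= eta2 * exp (L1 * e)).
    { intros r Hr Hre. apply Rle_trans with (eta2 * exp (L1 * r)).
      - apply (gronwall_lim0 D1 dD1); try lra; [exact K0|].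
        intros q Hq. split; [apply DD1; lra|].
        destruct (Lip1 q ltac:(lra)) as [B1 [B2 _]]; [left; apply Hz; lra|].
        destruct (Sq q) as [S1 [S2 [S3 [S4 [S5 [S6 S7]]]]]].
        specialize (B2 ltac:(lra)). unfold dD1, L1. lra.
      - apply Rmult_le_compat_l; [exact Heta0|].
        destruct (Req_dec r e) as [->|]; [lra|]. left. apply exp_increasing.
        apply Rmult_lt_compat_l; lra. }
    destruct (Sq t) as [_ [_ [_ [S4 [S5 [S6 _]]]]]].
    assert (HU := pow2_ge_0 (U t)).
    destruct (Rle_or_lt e t) as [Het|Hte].
    - assert (Hk1e : D1 e <= eta2 * exp (L1 * e)) by (apply Ph1; lra).
      destruct (Lip1 e ltac:(lra)) as [_ [_ [B3 _]]]; [left; apply Hz; lra|].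
      specialize (B3 eq_refl).
      destruct (Sq e) as [_ [_ [_ [S4e [S5e [S6e _]]]]]].
      assert (Hk2e : D2 e <= (1 + Ce) * exp (L1 * e) * eta2).
      { assert (Ce * D1 e <= Ce * (eta2 * exp (L1 * e)))
          by (apply Rmult_le_compat_l; lra). lra. }
      assert (Hk2 : D2 t <= D2 e * exp (L2 * (t - e))).
      { apply (gronwall D2 dD2); [exact Het|]. intros q Hq. split; [apply DD2; lra|].
        destruct (Lip1 q ltac:(lra)) as [B1 [_ [_ B4]]]; [left; apply Hz; lra|].
        destruct (Sq q) as [_ [_ [_ [S4q [S5q [S6q S7q]]]]]].
        specialize (B4 ltac:(lra)).
        assert (2 * u q * U q <= u q ^ 2 + U q ^ 2)
          by (generalize (pow2_ge_0 (u q - U q)); lra).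
        assert (u q ^ 2 + U q ^ 2 <= D2 q).
        { unfold D2, D1. generalize (pow2_ge_0 (w q)) (pow2_ge_0 (W q)). lra. }
        assert (3 * P3 * D1 q <= 3 * P3 * D2 q) by (apply Rmult_le_compat_l; lra).
        unfold dD2, dD1, L2. lra. }
      assert (Hx : exp (L2 * (t - e)) <= exp (L2 * tau)).
      { left. apply exp_increasing. apply Rmult_lt_compat_l; lra. }
      assert (Hxp := exp_pos (L2 * (t - e))).
      assert (Hk2t : D2 t <= K * eta2).
      { apply Rle_trans with (1 := Hk2).
        apply Rle_trans with ((1 + Ce) * exp (L1 * e) * eta2 * exp (L2 * (t - e))).
        - apply Rmult_le_compat_r; lra.
        - unfold K.
          replace ((1 + Ce) * exp (L1 * e) * exp (L2 * tau) * eta2)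
            with ((1 + Ce) * exp (L1 * e) * eta2 * exp (L2 * tau)) by ring.
          apply Rmult_le_compat_l; [|exact Hx].
          apply Rmult_le_pos; [apply Rmult_le_pos|]; lra. }
      lra.
    - split; [|lra].
      assert (E1 := Ph1 t ltac:(lra) ltac:(lra)).
      assert (eta2 * exp (L1 * e) <= eta2 * K) by (apply Rmult_le_compat_l; lra). lra. }
  (* Bootstrap: under this bound, [Est] returns the stronger [K * eta2 < c ^ 2 / 4]. *)
  assert (Close : forall t, 0 < t < T -> D1 t < c ^ 2 / 2).
  { assert (Hc22 : 0 < c ^ 2) by (apply pow_lt; lra).
    assert (Hle : eta2 <= K * eta2) by nra.
    apply real_induction.
    - assert (Hlt : 0 < c ^ 2 / 2 - eta2) by lra.
      generalize (filterlim_near _ _ _ K0 Hlt). apply filter_imp. intros; lra.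
    - intros q Hq Hz.
      apply (is_derive_locally_lt D1 q _ _ (DD1 q Hq)).
      apply Rle_lt_trans with (K * eta2); [|lra].
      enough (- (K * eta2) <= - D1 q) by lra.
      apply (derive_closure 0 (fun r => - D1 r) q _ _ (is_derive_opp D1 q _ (DD1 q Hq)));
        [lra|].
      intros t Ht. destruct (Est q ltac:(lra) Hz t Ht). lra. }
  assert (Hlate : tau < th').
  { apply Rnot_le_lt. intro Hle.
    assert (HT : T = th') by (apply Rmin_right; lra).
    apply (free_fall_not_end _ _ _ (th' / 2) (y2 (th' / 2)) c _ _ _ _ H'); try lra.
    - apply (ff_order _ _ _ _ _ _ _ H'); lra.
    - intros t Ht. split.
      + apply (free_fall_x2_mono _ _ _ th' _ _ _ _ H'); [lra|exact Hz2|lra|lra].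
      + apply (Near t); [lra|]. left. apply Close. lra. }
  assert (HT : T = tau) by (apply Rmin_left; lra).
  assert (Hets : e <= ts) by lra.
  destruct (Est T ltac:(lra) Close ts ltac:(lra)) as [_ Z]. specialize (Z Hets).
  assert (Hzts := Hz2 ts ltac:(lra)). unfold U in Z. nra.
Qed.

(** * Removing the regularization *)

Lemma Gam_derive_p1 (m q1 q2 p1 p2 : R) :
  0 < m -> q1 <> 0 \/ q2 <> 0 ->
  Derive (fun p => Gam m q1 q2 p p2) p1
    = q2 ^ 2 * p1 / 8 + (2 * q2 ^ 2 * p1 - 4 * q1 * q2 * p2) / (16 * m).
Proof.
  intros Hm Hq. assert (0 < q1 ^ 2 + q2 ^ 2) by nra.
  apply is_derive_unique. unfold Gam. auto_derive; [|field]; repeat split; nra.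
Qed.

(** The disjunction admits binary collisions: the formula is used at the start, where it gives the
    slope with which [Q2] leaves 0. *)
Lemma Gam_derive_p2 (m q1 q2 p1 p2 : R) :
  0 < m -> q1 <> 0 \/ q2 <> 0 ->
  Derive (fun p => Gam m q1 q2 p1 p) p2
    = (8 * q1 ^ 2 * p2 - 4 * q1 * q2 * p1) / (16 * m).
Proof.
  intros Hm Hq. assert (0 < q1 ^ 2 + q2 ^ 2) by nra.
  apply is_derive_unique. unfold Gam. auto_derive; [|field]; repeat split; nra.
Qed.

Lemma Gam_derive_q1 (m q1 q2 p1 p2 : R) :
  0 < m -> q1 <> 0 -> q2 <> 0 ->
  Derive (fun q => Gam m q q2 p1 p2) q1
    = (8 * q1 * p2 ^ 2 - 4 * q2 * p1 * p2) / (16 * m) - 2 * m ^ 2 * q1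
      - 4 * m * q1 * q2 ^ 4 / (q1 ^ 2 + q2 ^ 2) ^ 2
      - 2 * q1 * q2 ^ 4 / (2 * q1 ^ 2 + q2 ^ 2) ^ 2 + 2 * q1 * q2 ^ 2.
Proof.
  intros Hm H1 H2.
  assert (0 < q1 ^ 2) by (apply pow2_gt_0; exact H1).
  assert (0 < q2 ^ 2) by (apply pow2_gt_0; exact H2).
  apply is_derive_unique. unfold Gam. auto_derive; [|field]; repeat split; nra.
Qed.

Lemma Gam_derive_q2 (m q1 q2 p1 p2 : R) :
  0 < m -> q1 <> 0 -> q2 <> 0 ->
  Derive (fun q => Gam m q1 q p1 p2) q2
    = q2 * p1 ^ 2 / 8 + (2 * q2 * p1 ^ 2 - 4 * q1 * p1 * p2) / (16 * m)
      - 4 * m * q2 - 4 * m * q1 ^ 4 * q2 / (q1 ^ 2 + q2 ^ 2) ^ 2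
      - 4 * q1 ^ 4 * q2 / (2 * q1 ^ 2 + q2 ^ 2) ^ 2 + 2 * q1 ^ 2 * q2.
Proof.
  intros Hm H1 H2.
  assert (0 < q1 ^ 2) by (apply pow2_gt_0; exact H1).
  assert (0 < q2 ^ 2) by (apply pow2_gt_0; exact H2).
  apply is_derive_unique. unfold Gam. auto_derive; [|field]; repeat split; nra.
Qed.

Definition pos1 (Q1 Q2 : R -> R) (s : R) : R := Q1 s ^ 2 + Q2 s ^ 2 / 2.
Definition pos2 (Q2 : R -> R) (s : R) : R := Q2 s ^ 2 / 2.
(* From [P1 = 2 Q1 p1], [p1 = 2 v1] and [P2 = 2 Q2 p2], [p2 = v1 + m v2]. *)
Definition vel1 (Q1 P1 : R -> R) (s : R) : R := P1 s / (4 * Q1 s).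
Definition vel2 (m : R) (Q1 Q2 P1 P2 : R -> R) (s : R) : R :=
  (P2 s / (2 * Q2 s) - P1 s / (4 * Q1 s)) / m.

(* Off the level [Gam = 0] the two sides differ by multiples of [Gam]. *)
Lemma regularized_derive (m A a b s : R) (Q1 Q2 P1 P2 tau : R -> R) :
  0 < m -> regularized_motion m A a b Q1 Q2 P1 P2 tau -> a < s < b ->
  Q1 s <> 0 -> Q2 s <> 0 ->
  let d := Q1 s ^ 2 * Q2 s ^ 2 in
  is_derive (pos1 Q1 Q2) s (vel1 Q1 P1 s * d) /\
  is_derive (pos2 Q2) s (vel2 m Q1 Q2 P1 P2 s * d) /\
  is_derive (vel1 Q1 P1) s (acc1 m (pos1 Q1 Q2 s) (pos2 Q2 s) * d) /\
  is_derive (vel2 m Q1 Q2 P1 P2) s (acc2 m (pos1 Q1 Q2 s) (pos2 Q2 s) * d) /\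
  inner_energy m (pos2 Q2 s) (vel2 m Q1 Q2 P1 P2 s)
    = -1 - vel1 Q1 P1 s ^ 2 + outer_potential m (pos1 Q1 Q2 s) (pos2 Q2 s).
Proof.
  intros Hm H Hs HQ1 HQ2 d.
  assert (D1 := rm_Q1 _ _ _ _ _ _ _ _ _ H s Hs).
  assert (D2 := rm_Q2 _ _ _ _ _ _ _ _ _ H s Hs).
  assert (D3 := rm_P1 _ _ _ _ _ _ _ _ _ H s Hs).
  assert (D4 := rm_P2 _ _ _ _ _ _ _ _ _ H s Hs).
  assert (G := rm_level _ _ _ _ _ _ _ _ _ H s Hs).
  rewrite Gam_derive_p1 in D1 by auto. rewrite Gam_derive_p2 in D2 by auto.
  rewrite Gam_derive_q1 in D3 by auto. rewrite Gam_derive_q2 in D4 by auto.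
  assert (0 < Q1 s ^ 2) by (apply pow2_gt_0; exact HQ1).
  assert (0 < Q2 s ^ 2) by (apply pow2_gt_0; exact HQ2).
  assert (E1 := is_derive_unique _ _ _ D1). assert (E2 := is_derive_unique _ _ _ D2).
  assert (E3 := is_derive_unique _ _ _ D3). assert (E4 := is_derive_unique _ _ _ D4).
  unfold pos1, pos2, vel1, vel2, acc1, acc2, inner_energy, outer_potential, d in *.
  split; [|split; [|split; [|split]]].
  - auto_derive; [repeat split; eexists; eassumption|].
    change (Derive (fun r : R => Q1 r) s) with (Derive Q1 s).
    change (Derive (fun r : R => Q2 r) s) with (Derive Q2 s).
    rewrite E1, E2. field. lra.
  - auto_derive; [repeat split; eexists; eassumption|].
    change (Derive (fun r : R => Q2 r) s) with (Derive Q2 s).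
    rewrite E2. field. lra.
  - auto_derive; [repeat split; try (eexists; eassumption); lra|].
    change (Derive (fun r : R => Q1 r) s) with (Derive Q1 s).
    change (Derive (fun r : R => P1 r) s) with (Derive P1 s).
    rewrite E1, E3.
    apply Rminus_diag_uniq.
    match goal with |- ?X = 0 =>
      replace X with (- Gam m (Q1 s) (Q2 s) (P1 s) (P2 s) / (2 * Q1 s ^ 2)) end.
    + rewrite G. field. lra.
    + unfold Gam. field. repeat split; nra.
  - auto_derive; [repeat split; try (eexists; eassumption); lra|].
    change (Derive (fun r : R => Q1 r) s) with (Derive Q1 s).
    change (Derive (fun r : R => Q2 r) s) with (Derive Q2 s).
    change (Derive (fun r : R => P1 r) s) with (Derive P1 s).
    change (Derive (fun r : R => P2 r) s) with (Derive P2 s).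
    rewrite E1, E2, E3, E4.
    apply Rminus_diag_uniq.
    match goal with |- ?X = 0 =>
      replace X with (Gam m (Q1 s) (Q2 s) (P1 s) (P2 s) *
        (/ (2 * Q1 s ^ 2) - / (Q2 s ^ 2)) / m) end.
    + rewrite G. field. lra.
    + unfold Gam. field. repeat split; nra.
  - apply Rminus_diag_uniq.
    match goal with |- ?X = 0 =>
      replace X with (Gam m (Q1 s) (Q2 s) (P1 s) (P2 s) / (Q1 s ^ 2 * Q2 s ^ 2)) end.
    + rewrite G. field. lra.
    + unfold Gam. field. repeat split; nra.
Qed.

(** The rate of physical time vanishes at collisions, which are the endpoints here, so strictness is
    taken from the middle third of [[r, s]]. *)
Lemma increasing_of_derive (tau dtau : R -> R) (sg : R) :
  (forall s, 0 <= s <= sg -> is_derive tau s (dtau s) /\ 0 <= dtau s) ->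
  (forall s, 0 < s < sg -> 0 < dtau s) ->
  forall r s, 0 <= r -> r < s -> s <= sg -> tau r < tau s.
Proof.
  intros Hd Hpos r s Hr Hrs Hs.
  set (p := (s + 2 * r) / 3). set (q := (2 * s + r) / 3).
  assert (Hpq : r < p /\ p < q /\ q < s) by (unfold p, q; lra).
  assert (G1 : 0 * (p - r) <= tau p - tau r)
    by (apply (derive_ge tau dtau); [lra|]; intros; apply Hd; lra).
  assert (G2 : 0 * (s - q) <= tau s - tau q)
    by (apply (derive_ge tau dtau); [lra|]; intros; apply Hd; lra).
  assert (G3 : 0 * (q - p) < tau q - tau p).
  { apply (derive_gt tau dtau); [lra|]. intros t Ht. split; [apply Hd|apply Hpos]; lra. }
  lra.
Qed.

Lemma intermediate_value_derive (tau dtau : R -> R) (sg t : R) :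
  0 < sg -> (forall s, 0 <= s <= sg -> is_derive tau s (dtau s)) ->
  tau 0 < t < tau sg -> exists s, 0 < s < sg /\ tau s = t.
Proof.
  intros Hsg Hd Ht.
  destruct (Ranalysis5.IVT_interv (fun s => tau s - t) 0 sg) as [s [Hs E]]; try lra.
  - intros s Hs. apply continuity_pt_filterlim.
    apply (ex_derive_continuous (fun s => tau s - t)).
    exists (dtau s - 0). apply (is_derive_minus tau (fun _ => t)); [now apply Hd|].
    apply (is_derive_const t s).
  - assert (E' : tau s = t) by lra. exists s. split; [|exact E'].
    split; apply Rnot_le_lt; intro Hle;
      [assert (s = 0) by lra | assert (s = sg) by lra]; subst s; lra.
Qed.

(** Chain rule for the inverse of [tau] without forming the inverse. [k = g - v * tau] has
    derivative 0 at [s], and the error of the difference quotient of [f] is the quotient of [k]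
    divided by that of [tau], which exceeds [d / 2]. *)
Lemma is_derive_time_change (tau dtau f g : R -> R) (sg s v : R) :
  (forall r, 0 <= r <= sg -> is_derive tau r (dtau r) /\ 0 <= dtau r) ->
  (forall r, 0 < r < sg -> 0 < dtau r) ->
  (forall r, 0 < r < sg -> f (tau r) = g r) ->
  0 < s < sg -> is_derive g s (v * dtau s) -> is_derive f (tau s) v.
Proof.
  intros Hd Hpos Hfg Hs Hg.
  assert (Hds := Hpos s Hs). set (d := dtau s) in *.
  assert (Hinc := increasing_of_derive tau dtau sg Hd Hpos).
  assert (Ht : is_derive tau s d) by (apply Hd; lra).
  apply is_derive_Reals. intros eps Heps.
  set (k := fun r => g r - v * tau r).
  assert (Hk : is_derive k s 0).
  { evar_last.
    - apply (is_derive_minus g (fun r => v * tau r) s); [exact Hg|].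
      apply (is_derive_scal tau s v), Ht.
    - unfold minus, plus, opp, scal; simpl. ring. }
  apply is_derive_Reals in Hk. apply is_derive_Reals in Ht.
  destruct (Ht (d / 2) ltac:(lra)) as [d1 H1].
  destruct (Hk (eps * d / 4) ltac:(nra)) as [d2 H2].
  set (e := Rmin (Rmin d1 d2) (Rmin s (sg - s)) / 2).
  assert (M1 := Rmin_l (Rmin d1 d2) (Rmin s (sg - s))).
  assert (M2 := Rmin_r (Rmin d1 d2) (Rmin s (sg - s))).
  assert (M3 := Rmin_l d1 d2). assert (M4 := Rmin_r d1 d2).
  assert (M5 := Rmin_l s (sg - s)). assert (M6 := Rmin_r s (sg - s)).
  assert (He : 0 < e).
  { unfold e. apply Rdiv_lt_0_compat; [|lra].
    repeat apply Rmin_pos; try apply cond_pos; lra. }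
  assert (I1 := Hinc (s - e) s ltac:(unfold e in *; lra) ltac:(lra) ltac:(lra)).
  assert (I2 := Hinc s (s + e) ltac:(lra) ltac:(lra) ltac:(unfold e in *; lra)).
  assert (Hdel : 0 < Rmin (tau s - tau (s - e)) (tau (s + e) - tau s))
    by (apply Rmin_pos; lra).
  exists (mkposreal _ Hdel). intros h Hh Hlt. simpl in Hlt.
  assert (N1 := Rmin_l (tau s - tau (s - e)) (tau (s + e) - tau s)).
  assert (N2 := Rmin_r (tau s - tau (s - e)) (tau (s + e) - tau s)).
  apply Rabs_def2 in Hlt.
  destruct (intermediate_value_derive tau dtau sg (tau s + h)) as [r [Hr Er]];
    [lra|intros; now apply Hd| |].
  { assert (J1 : tau 0 <= tau (s - e)).
    { destruct (Req_dec (s - e) 0) as [->|]; [lra|].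
      left. apply Hinc; unfold e in *; lra. }
    assert (J2 : tau (s + e) <= tau sg).
    { destruct (Req_dec (s + e) sg) as [->|]; [lra|].
      left. apply Hinc; unfold e in *; lra. }
    lra. }
  assert (Hrs : s - e < r < s + e).
  { split; apply Rnot_le_lt; intros [Hlt'|Heq].
    - generalize (Hinc r (s - e) ltac:(lra) Hlt' ltac:(lra)). lra.
    - subst r. lra.
    - generalize (Hinc (s + e) r ltac:(lra) Hlt' ltac:(lra)). lra.
    - subst r. lra. }
  assert (Hne : r - s <> 0) by (intro; assert (r = s) by lra; subst r; lra).
  assert (Ha : Rabs (r - s) < e) by (apply Rabs_def1; lra).
  specialize (H1 (r - s) Hne ltac:(unfold e in *; lra)).
  specialize (H2 (r - s) Hne ltac:(unfold e in *; lra)).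
  replace (s + (r - s)) with r in H1, H2 by ring.
  rewrite <- Er, Hfg, Hfg by lra.
  replace h with (tau r - tau s) in * by lra.
  set (x := (tau r - tau s) / (r - s)) in *.
  assert (Hx : d / 2 < x) by (apply Rabs_def2 in H1; lra).
  replace ((g r - g s) / (tau r - tau s) - v)
    with ((k r - k s) / (r - s) * / x) by (unfold k, x; field; lra).
  rewrite Rminus_0_r in H2.
  rewrite Rabs_mult, (Rabs_pos_eq (/ x)) by (left; apply Rinv_0_lt_compat; lra).
  apply Rmult_lt_reg_r with x; [lra|]. rewrite Rmult_assoc, Rinv_l by lra. nra.
Qed.

Lemma at_right_time_change (tau dtau : R -> R) (sg : R) (P : R -> Prop) :
  (forall r, 0 <= r <= sg -> is_derive tau r (dtau r) /\ 0 <= dtau r) ->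
  (forall r, 0 < r < sg -> 0 < dtau r) -> 0 < sg -> tau 0 = 0 ->
  at_right 0 (fun s => P (tau s)) -> at_right 0 P.
Proof.
  intros Hd Hpos Hsg H0 HP.
  assert (Hinc := increasing_of_derive tau dtau sg Hd Hpos).
  apply at_right0_iff in HP. destruct HP as [d [Hd0 HP]].
  assert (Hmn : 0 < Rmin d sg) by (apply Rmin_pos; lra).
  assert (M1 := Rmin_l d sg). assert (M2 := Rmin_r d sg).
  apply at_right0_iff. exists (tau (Rmin d sg)).
  split; [rewrite <- H0; apply Hinc; lra|]. intros t Ht.
  destruct (intermediate_value_derive tau dtau (Rmin d sg) t Hmn) as [s [Hs <-]].
  - intros r Hr. apply Hd; lra.
  - lra.
  - apply HP; lra.
Qed.

Lemma at_left_time_change (tau dtau : R -> R) (sg : R) (P : R -> Prop) :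
  (forall r, 0 <= r <= sg -> is_derive tau r (dtau r) /\ 0 <= dtau r) ->
  (forall r, 0 < r < sg -> 0 < dtau r) -> 0 < sg ->
  at_left sg (fun s => P (tau s)) -> at_left (tau sg) P.
Proof.
  intros Hd Hpos Hsg HP.
  assert (Hinc := increasing_of_derive tau dtau sg Hd Hpos).
  apply at_left_iff in HP. destruct HP as [d [Hd0 HP]].
  assert (Hmn : 0 < Rmin d sg) by (apply Rmin_pos; lra).
  assert (M1 := Rmin_l d sg). assert (M2 := Rmin_r d sg).
  set (r := sg - Rmin d sg / 2).
  assert (Hr : 0 < r /\ sg - d < r /\ r < sg) by (unfold r; lra).
  assert (I := Hinc r sg ltac:(lra) ltac:(lra) ltac:(lra)).
  apply at_left_iff. exists (tau sg - tau r). split; [lra|]. intros t Ht.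
  assert (I0 := Hinc 0 r ltac:(lra) ltac:(lra) ltac:(lra)).
  destruct (intermediate_value_derive tau dtau sg t Hsg) as [s [Hs <-]].
  - intros q Hq. apply Hd; lra.
  - lra.
  - apply HP. split; [|lra]. apply Rnot_le_lt. intro Hle.
    generalize (Hinc s r ltac:(lra) ltac:(lra) ltac:(lra)). lra.
Qed.

Lemma lim0_time_change (tau dtau f g : R -> R) (sg l : R) :
  (forall r, 0 <= r <= sg -> is_derive tau r (dtau r) /\ 0 <= dtau r) ->
  (forall r, 0 < r < sg -> 0 < dtau r) -> 0 < sg -> tau 0 = 0 ->
  (forall r, 0 < r < sg -> f (tau r) = g r) -> ex_derive g 0 -> g 0 = l ->
  filterlim f (at_right 0) (locally l).
Proof.
  intros Hd Hpos Hsg H0 Hfg Hg <- P HP.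
  apply (at_right_time_change tau dtau sg); try assumption.
  assert (G : at_right 0 (fun s => P (g s))).
  { apply filter_le_within. exact (ex_derive_continuous g 0 Hg P HP). }
  generalize (filter_and (F := at_right 0) _ _ G (at_right0_below sg Hsg)).
  apply filter_imp. intros s [H1 H2]. now rewrite Hfg.
Qed.

(** The free fall ends at the first positive time when [Q1] or [Q2] vanishes, at the latest at the
    SBC. If [v2] has not become negative, [Q2] cannot be the one, so this end is the first SBC. *)
Lemma free_fall_of_motion (m A T : R) (x1 x2 : R -> R) :
  0 < m -> 0 < A -> motion_through m A T x1 x2 -> first_SBC x1 x2 T ->
  exists th v1 v2, free_fall m A th x1 x2 v1 v2 /\
    ((forall t, 0 < t < th -> 0 <= v2 t) -> th = T) /\ th <= T.
Proof.
  intros Hm HA [a [b [sT [Q1 [Q2 [P1 [P2 [tau [Ha [HsT [HT [RM HX]]]]]]]]]]]] [HT0 [[HS1 HS2] HSf]].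
  assert (Htau := rm_tau _ _ _ _ _ _ _ _ _ RM).
  assert (Htau0 := rm_tau0 _ _ _ _ _ _ _ _ _ RM).
  set (dtau := fun s => Q1 s ^ 2 * Q2 s ^ 2) in *.
  assert (Hdnn : forall s, 0 <= dtau s) by (intros s; apply Rmult_le_pos; apply pow2_ge_0).
  (* [h] is the rate of [Q2], continuous through the collision and positive at 0. Since
     [v2 = h / (Q1 ^ 2 * Q2)], it also gives the sign of [v2] just after the start. *)
  set (h := fun s => (8 * Q1 s ^ 2 * P2 s - 4 * Q1 s * Q2 s * P1 s) / (16 * m)).
  assert (DQ2 : forall s, a < s < b -> is_derive Q2 s (h s)).
  { intros s Hs. generalize (rm_Q2 _ _ _ _ _ _ _ _ _ RM s Hs).
    rewrite Gam_derive_p2; [auto|exact Hm|].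
    exact (rm_no_collapse _ _ _ _ _ _ _ _ _ RM s Hs). }
  assert (Ex : forall s, a < s < b ->
    (ex_derive Q1 s /\ ex_derive Q2 s) /\ (ex_derive P1 s /\ ex_derive P2 s)).
  { intros s Hs. split; split; eexists.
    - exact (rm_Q1 _ _ _ _ _ _ _ _ _ RM s Hs).
    - exact (rm_Q2 _ _ _ _ _ _ _ _ _ RM s Hs).
    - exact (rm_P1 _ _ _ _ _ _ _ _ _ RM s Hs).
    - exact (rm_P2 _ _ _ _ _ _ _ _ _ RM s Hs). }
  assert (H0ab : a < 0 < b) by lra.
  destruct (Ex 0 H0ab) as [[Ex1 Ex2] [Ex3 Ex4]].
  assert (Q10 := rm_Q1_0 _ _ _ _ _ _ _ _ _ RM).
  assert (Q20 := rm_Q2_0 _ _ _ _ _ _ _ _ _ RM).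
  assert (P10 := rm_P1_0 _ _ _ _ _ _ _ _ _ RM).
  assert (P20 := rm_P2_0 _ _ _ _ _ _ _ _ _ RM).
  assert (HsA : 0 < sqrt A) by now apply sqrt_lt_R0.
  assert (HsA2 : sqrt A ^ 2 = A) by (apply pow2_sqrt; lra).
  assert (Start : at_right 0 (fun s => (0 < Q1 s /\ 0 < Q2 s) /\ 0 < h s)).
  { destruct Ex1 as [dQ1 D1].
    assert (Eh : ex_derive h 0) by (unfold h; auto_derive; repeat split; try assumption; now exists dQ1).
    destruct Eh as [dh Dh].
    assert (Hh0 : 0 < h 0).
    { unfold h. rewrite Q10, Q20, P10, P20, HsA2.
      assert (0 < Rpower m (3 / 2)) by (unfold Rpower; apply exp_pos).
      apply Rdiv_lt_0_compat; [|lra].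
      assert (0 < A * Rpower m (3 / 2)) by (apply Rmult_lt_0_compat; lra). lra. }
    assert (L1 := is_derive_locally_gt Q1 0 _ 0 D1 ltac:(rewrite Q10; exact HsA)).
    assert (L2 := is_derive_locally_gt h 0 _ 0 Dh Hh0).
    assert (L := filter_and (F := locally (0 : R)) _ _ L1 L2).
    apply locally_R in L. destruct L as [d [Hd L]].
    assert (Hmn : 0 < Rmin d b) by (apply Rmin_pos; lra).
    assert (M1 := Rmin_l d b). assert (M2 := Rmin_r d b).
    apply at_right0_iff. exists (Rmin d b). split; [exact Hmn|]. intros s Hs.
    destruct (L s ltac:(lra)) as [S1 S2]. split; [split|]; [exact S1| |exact S2].
    rewrite <- Q20. enough (0 * (s - 0) < Q2 s - Q2 0) by lra.
    apply (derive_gt Q2 h); [lra|]. intros r Hr.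
    split; [apply DQ2; lra|]. apply L; lra. }
  assert (HQT : Q1 sT = 0).
  { destruct (HX sT ltac:(lra)) as [X1 X2]. rewrite HT in X1, X2.
    assert (Q1 sT ^ 2 = 0) by lra. now apply Rsqr_0_uniq; rewrite Rsqr_pow2. }
  destruct (first_failure (fun s => 0 < Q1 s /\ 0 < Q2 s) sT) as [sg [Hsg [Hin Hout]]];
    [|lra|rewrite HQT; lra|].
  { revert Start. apply filter_imp. tauto. }
  assert (Hsgab : a < sg < b) by lra.
  assert (Hend : Q1 sg = 0 \/ Q2 sg = 0).
  { apply NNPP. intro Hn. apply not_or_and in Hn. destruct Hn as [N1 N2]. apply Hout.
    destruct (Ex sg Hsgab) as [[[d1 D1] [d2 D2]] _].
    assert (0 <= Q1 sg)
      by (apply (derive_closure 0 Q1 sg _ 0 D1); [lra|]; intros; left; now apply Hin).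
    assert (0 <= Q2 sg)
      by (apply (derive_closure 0 Q2 sg _ 0 D2); [lra|]; intros; left; now apply Hin).
    apply filter_and.
    - apply (is_derive_locally_gt Q1 sg _ _ D1). lra.
    - apply (is_derive_locally_gt Q2 sg _ _ D2). lra. }
  assert (Hd : forall r, 0 <= r <= sg -> is_derive tau r (dtau r) /\ 0 <= dtau r).
  { intros r Hr. split; [apply Htau; lra|apply Hdnn]. }
  assert (Hpos : forall r, 0 < r < sg -> 0 < dtau r).
  { intros r Hr. destruct (Hin r Hr). apply Rmult_lt_0_compat; apply pow_lt; assumption. }
  assert (Hsg0 : 0 < sg) by lra.
  assert (Hinc := increasing_of_derive tau dtau sg Hd Hpos).
  assert (Hth : 0 < tau sg) by (rewrite <- Htau0; apply Hinc; lra).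
  assert (Honto : forall t, 0 < t < tau sg -> exists s, 0 < s < sg /\ tau s = t).
  { intros t Ht. apply (intermediate_value_derive tau dtau sg t Hsg0).
    - intros s Hs. now apply Hd.
    - now rewrite Htau0. }
  assert (X1 : forall r, 0 < r < sg -> x1 (tau r) = pos1 Q1 Q2 r)
    by (intros r Hr; apply HX; lra).
  assert (X2 : forall r, 0 < r < sg -> x2 (tau r) = pos2 Q2 r)
    by (intros r Hr; apply HX; lra).
  assert (Reg := fun s (Hs : 0 < s < sg) => regularized_derive m A a b s Q1 Q2 P1 P2 tau Hm RM
    (conj (Rlt_trans _ _ _ Ha (proj1 Hs)) (Rlt_trans _ _ _ (proj2 Hs) (proj2 Hsgab)))
    (Rgt_not_eq _ _ (proj1 (Hin s Hs))) (Rgt_not_eq _ _ (proj2 (Hin s Hs)))).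
  assert (DX1 : forall s, 0 < s < sg -> is_derive x1 (tau s) (vel1 Q1 P1 s)).
  { intros s Hs. apply (is_derive_time_change tau dtau x1 (pos1 Q1 Q2) sg); try assumption.
    apply (Reg s Hs). }
  assert (DX2 : forall s, 0 < s < sg -> is_derive x2 (tau s) (vel2 m Q1 Q2 P1 P2 s)).
  { intros s Hs. apply (is_derive_time_change tau dtau x2 (pos2 Q2) sg); try assumption.
    apply (Reg s Hs). }
  assert (V1 : forall s, 0 < s < sg -> Derive x1 (tau s) = vel1 Q1 P1 s)
    by (intros s Hs; apply is_derive_unique; now apply DX1).
  assert (V2 : forall s, 0 < s < sg -> Derive x2 (tau s) = vel2 m Q1 Q2 P1 P2 s)
    by (intros s Hs; apply is_derive_unique; now apply DX2).
  assert (FF : free_fall m A (tau sg) x1 x2 (Derive x1) (Derive x2)).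
  { constructor.
    - exact Hth.
    - intros t Ht. destruct (Honto t Ht) as [s [Hs <-]]. rewrite X1, X2 by exact Hs.
      destruct (Hin s Hs). unfold pos1, pos2.
      assert (0 < Q1 s ^ 2) by now apply pow_lt.
      assert (0 < Q2 s ^ 2) by now apply pow_lt. lra.
    - intros t Ht. destruct (Honto t Ht) as [s [Hs <-]]. rewrite V1 by exact Hs. now apply DX1.
    - intros t Ht. destruct (Honto t Ht) as [s [Hs <-]]. rewrite V2 by exact Hs. now apply DX2.
    - intros t Ht. destruct (Honto t Ht) as [s [Hs <-]]. rewrite X1, X2 by exact Hs.
      apply (is_derive_time_change tau dtau (Derive x1) (vel1 Q1 P1) sg); try assumption.
      apply (Reg s Hs).
    - intros t Ht. destruct (Honto t Ht) as [s [Hs <-]]. rewrite X1, X2 by exact Hs.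
      apply (is_derive_time_change tau dtau (Derive x2) (vel2 m Q1 Q2 P1 P2) sg);
        try assumption.
      apply (Reg s Hs).
    - intros t Ht. destruct (Honto t Ht) as [s [Hs <-]].
      rewrite X1, X2, V1, V2 by exact Hs. apply (Reg s Hs).
    - apply (lim0_time_change tau dtau x1 (pos1 Q1 Q2) sg); try assumption.
      + unfold pos1. auto_derive. repeat split; assumption.
      + unfold pos1. rewrite Q10, Q20, HsA2. field.
    - apply (lim0_time_change tau dtau x2 (pos2 Q2) sg); try assumption.
      + unfold pos2. auto_derive. repeat split; assumption.
      + unfold pos2. rewrite Q20. field.
    - apply (lim0_time_change tau dtau (Derive x1) (vel1 Q1 P1) sg); try assumption.
      + unfold vel1. auto_derive. rewrite Q10. repeat split; try assumption. lra.
      + unfold vel1. rewrite P10, Q10. field. lra.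
    (* The energy relation replaces the inner energy, a difference of infinite terms, by an
       expression that is regular at [s = 0]. *)
    - apply (lim0_time_change tau dtau _
        (fun s => -1 - vel1 Q1 P1 s ^ 2 + outer_potential m (pos1 Q1 Q2 s) (pos2 Q2 s)) sg);
        try assumption.
      + intros r Hr. rewrite X2, V2 by exact Hr. apply (Reg r Hr).
      + unfold vel1, outer_potential, pos1, pos2. auto_derive.
        rewrite Q10, Q20. repeat split; try assumption; nra.
      + unfold vel1, outer_potential, pos1, pos2. rewrite P10, Q10, Q20, HsA2. field. lra.
    - apply (at_right_time_change tau dtau sg); try assumption.
      generalize (filter_and (F := at_right 0) _ _ Start (at_right0_below sg Hsg0)).
      apply filter_imp. intros s [[[S1 S2] S3] Hs]. rewrite V2 by exact Hs.
      replace (vel2 m Q1 Q2 P1 P2 s) with (h s / (Q1 s ^ 2 * Q2 s))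
        by (unfold h, vel2; field; lra).
      apply Rdiv_lt_0_compat; [exact S3|]. apply Rmult_lt_0_compat; [now apply pow_lt|exact S2].
    - intros P HP.
      apply (at_left_time_change tau dtau sg); try assumption.
      set (g := fun s => Q2 s ^ 2 / 2 * Q1 s ^ 2).
      assert (Hg : ex_derive g sg).
      { destruct (Ex sg Hsgab) as [[E1 E2] _]. unfold g. auto_derive.
        repeat split; assumption. }
      assert (Hg0 : g sg = 0) by (unfold g; destruct Hend as [-> | ->]; field).
      rewrite <- Hg0 in HP.
      assert (G : at_left sg (fun s => P (g s))).
      { apply filter_le_within. exact (ex_derive_continuous g sg Hg P HP). }
      assert (G' : at_left sg (fun s => 0 < s < sg)).
      { apply at_left_iff. exists sg. split; [exact Hsg0|]. intros; lra. }
      generalize (filter_and (F := at_left sg) _ _ G G'). apply filter_imp.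
      intros s [P1' Hs]. rewrite X1, X2 by exact Hs. unfold pos1, pos2.
      unfold g in P1'.
      now replace (Q2 s ^ 2 / 2 * (Q1 s ^ 2 + Q2 s ^ 2 / 2 - Q2 s ^ 2 / 2))
        with (Q2 s ^ 2 / 2 * Q1 s ^ 2) by ring. }
  assert (HthT : tau sg <= T).
  { rewrite <- HT. enough (0 * (sT - sg) <= tau sT - tau sg) by lra.
    apply (derive_ge tau dtau); [lra|]. intros r Hr. split; [apply Htau; lra|apply Hdnn]. }
  exists (tau sg), (Derive x1), (Derive x2). split; [exact FF|]. split; [|exact HthT].
  intros Hv.
  (* An inner collision would bring [x2] back to 0 against [v2 >= 0]. The rate is written [Q2 * h]
     because this form is also valid at [sg], where [v2] need not exist. *)
  assert (HQ2 : Q2 sg <> 0).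
  { intro Hz.
    assert (G : 0 * (sg - sg / 2) <= pos2 Q2 sg - pos2 Q2 (sg / 2)).
    { apply (derive_ge (pos2 Q2) (fun s => Q2 s * h s)); [lra|]. intros r Hr.
      assert (D : is_derive (pos2 Q2) r (Q2 r * h r)).
      { assert (D2 := DQ2 r ltac:(lra)). unfold pos2.
        auto_derive; [now exists (h r)|].
        replace (Derive (fun q : R => Q2 q) r) with (h r)
          by (symmetry; exact (is_derive_unique _ _ _ D2)). field. }
      split; [exact D|].
      destruct (Req_dec r sg) as [->|Hne]; [rewrite Hz; lra|].
      assert (Hr' : 0 < r < sg) by lra.
      assert (D' := proj1 (proj2 (Reg r Hr'))).
      rewrite <- (is_derive_unique _ _ _ D), (is_derive_unique _ _ _ D').
      apply Rmult_le_pos; [|apply Hdnn]. rewrite <- V2 by exact Hr'. apply Hv.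
      split; [rewrite <- Htau0|]; apply Hinc; lra. }
    destruct (Hin (sg / 2) ltac:(lra)) as [_ S2].
    assert (0 < Q2 (sg / 2) ^ 2) by now apply pow_lt.
    unfold pos2 in G. rewrite Hz in G. lra. }
  assert (HQ1 : Q1 sg = 0) by tauto.
  apply Rle_antisym; [exact HthT|]. apply Rnot_lt_le. intro Hlt.
  apply (HSf (tau sg)); [lra|].
  destruct (HX sg Hsgab) as [Y1 Y2]. unfold SBC. rewrite Y1, Y2, HQ1.
  assert (0 < Q2 sg ^ 2) by (apply pow2_gt_0; exact HQ2).
  split; lra.
Qed.

(* The velocity [v2] stays positive and bounded away from [0] on the left of the
   collision because [acc2] tends to infinity there. *)
Lemma x2_not_stationary_at_SBC (m A th : R) (x1 x2 v1 v2 : R -> R) :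
  0 < m -> free_fall m A th x1 x2 v1 v2 ->
  (forall t, 0 < t < th -> 0 <= v2 t) -> ~ is_derive x2 th 0.
Proof.
  intros Hm H Hv D.
  assert (Hth := ff_th _ _ _ _ _ _ _ H).
  set (b := x2 (th / 2)).
  assert (Hb : 0 < b) by (apply (ff_order _ _ _ _ _ _ _ H); lra).
  (* The attractive terms of [acc2] are at most [M - 1], so a gap below [/ M] gives acceleration at
     least 1. *)
  set (M := (m / 4 + 1) * / b ^ 2 + 1).
  assert (Hib : 0 < / b ^ 2) by (apply Rinv_0_lt_compat, pow_lt; exact Hb).
  assert (HM : 1 < M) by (unfold M; nra).
  assert (G := filterlim_near _ _ (b / M) (ff_end _ _ _ _ _ _ _ H)
                 ltac:(apply Rdiv_lt_0_compat; lra)).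
  apply at_left_iff in G. destruct G as [d [Hd G]].
  assert (Hmn : 0 < Rmin d (th / 2)) by (apply Rmin_pos; lra).
  assert (M1 := Rmin_l d (th / 2)). assert (M2 := Rmin_r d (th / 2)).
  set (l := Rmin d (th / 2)) in *.
  assert (Hacc : forall t, th - l < t < th -> 1 <= acc2 m (x1 t) (x2 t)).
  { intros t Ht. specialize (G t ltac:(lra)).
    assert (Ho := ff_order _ _ _ _ _ _ _ H t ltac:(lra)).
    assert (Hx : b <= x2 t)
      by (apply (free_fall_x2_mono _ _ _ th _ _ _ _ H); [lra|exact Hv|lra|lra]).
    assert (Hgap : x1 t - x2 t < / M).
    { apply Rmult_lt_reg_l with b; [exact Hb|].
      apply Rle_lt_trans with (x2 t * (x1 t - x2 t)); [nra|]. unfold Rdiv in G. lra. }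
    assert (Hi : M < / (x1 t - x2 t)).
    { rewrite <- (Rinv_inv M). apply Rinv_lt_contravar; [|exact Hgap].
      apply Rmult_lt_0_compat; [lra|]. apply Rinv_0_lt_compat; lra. }
    assert (Hi2 : M < / (x1 t - x2 t) ^ 2) by (rewrite <- pow_inv; nra).
    assert (J1 : / x2 t ^ 2 <= / b ^ 2) by (apply inv_sq_le; lra).
    assert (J2 : / (x1 t + x2 t) ^ 2 <= / b ^ 2) by (apply inv_sq_le; lra).
    assert (m / 4 * / x2 t ^ 2 <= m / 4 * / b ^ 2) by (apply Rmult_le_compat_l; lra).
    unfold acc2, M in *. lra. }
  set (k := l / 4).
  assert (Hvk : forall t, th - l / 2 <= t < th -> k <= v2 t).
  { intros t Ht.
    assert (1 * (t - (th - 3 * l / 4)) <= v2 t - v2 (th - 3 * l / 4)).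
    { apply (derive_ge v2 (fun r => acc2 m (x1 r) (x2 r))); [lra|]. intros r Hr.
      split; [apply (ff_v2 _ _ _ _ _ _ _ H)|apply Hacc]; lra. }
    generalize (Hv (th - 3 * l / 4) ltac:(lra)). unfold k. lra. }
  (* With [x2] stationary at [th], [f] would have slope [- k] there, although it does not decrease
     on the left. *)
  set (f := fun t => x2 t - k * t).
  assert (Df : is_derive f th (- k)).
  { evar_last.
    - apply (is_derive_minus x2 (fun t => k * t) th); [exact D|].
      apply (is_derive_scal (fun t => t) th k), (is_derive_id th).
    - unfold minus, plus, opp, scal, one; simpl. unfold mult; simpl. ring. }
  destruct (is_derive_pos_sign (fun t => - f t) th _ (is_derive_opp f th _ Df))
    as [e [He [Hl _]]]; [unfold opp, k; simpl; lra|].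
  assert (Hme : 0 < Rmin e (l / 2)) by (apply Rmin_pos; lra).
  assert (N1 := Rmin_l e (l / 2)). assert (N2 := Rmin_r e (l / 2)).
  set (t0 := th - Rmin e (l / 2) / 2).
  assert (Hft : f th < f t0) by (specialize (Hl t0 ltac:(unfold t0; lra)); lra).
  assert (f t0 <= f th); [|lra].
  apply (derive_closure t0 f th _ _ Df); [unfold t0; lra|]. intros t Ht.
  assert (k * (t - t0) <= x2 t - x2 t0); [|unfold f; lra].
  apply (derive_ge x2 v2); [lra|]. intros r Hr. unfold t0 in *.
  split; [apply (ff_x2 _ _ _ _ _ _ _ H); lra|apply Hvk; lra].
Qed.

(** * Turning points and the threshold [A0] *)

(** If [v2] becomes negative, a turning point occurs before [th], whichever collision happens there.
    Otherwise [th = T], so the free fall covers all candidates except [T] itself. *)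
Lemma turning_point_iff (m A T : R) (x1 x2 : R -> R) :
  0 < m -> 0 < A -> motion_through m A T x1 x2 -> first_SBC x1 x2 T ->
  exists th v1 v2, free_fall m A th x1 x2 v1 v2 /\
    (has_turning_point x2 T <-> exists t, 0 < t < th /\ v2 t < 0).
Proof.
  intros Hm HA HM HS.
  destruct (free_fall_of_motion m A T x1 x2 Hm HA HM HS) as [th [v1 [v2 [FF [Heq Hle]]]]].
  exists th, v1, v2. split; [exact FF|]. split.
  - intros [ts [Hts [D [ta [tb [Hab Hsign]]]]]]. apply NNPP. intro Hno.
    assert (Hv : forall t, 0 < t < th -> 0 <= v2 t).
    { intros t Ht. apply Rnot_lt_le. intro. apply Hno. now exists t. }
    specialize (Heq Hv). subst T.
    destruct (Req_dec ts th) as [->|Hne].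
    + exact (x2_not_stationary_at_SBC _ _ _ _ _ _ _ Hm FF Hv D).
    + assert (Hneg : exists t, 0 < t < th /\ exists v, is_derive x2 t v /\ v < 0).
      { destruct Hsign as [[_ Hr]|[Hl _]].
        - assert (0 < Rmin (tb - ts) (th - ts)) by (apply Rmin_pos; lra).
          assert (L1 := Rmin_l (tb - ts) (th - ts)). assert (L2 := Rmin_r (tb - ts) (th - ts)).
          exists (ts + Rmin (tb - ts) (th - ts) / 2). split; [lra|]. apply Hr. lra.
        - assert (0 < Rmin (ts - ta) ts) by (apply Rmin_pos; lra).
          assert (L1 := Rmin_l (ts - ta) ts). assert (L2 := Rmin_r (ts - ta) ts).
          exists (ts - Rmin (ts - ta) ts / 2). split; [lra|]. apply Hl. lra. }
      destruct Hneg as [t [Ht [v [Dv Hvn]]]].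
      assert (E := is_derive_unique _ _ _ Dv).
      rewrite (is_derive_unique _ _ _ (ff_x2 _ _ _ _ _ _ _ FF t Ht)) in E.
      generalize (Hv t Ht). lra.
  - intros [t [Ht Hneg]].
    destruct (reversal_turning _ _ _ _ _ _ _ _ Hm FF Ht Hneg) as [ts [Hts Htt]].
    exists ts. split; [lra|exact Htt].
Qed.

Theorem theorem1 (m : R) (hm : 0 < m) :
  exists A0 : R, 0 < A0 /\
    forall (A t1 : R) (x1 x2 : R -> R),
      0 < A ->
      motion_through m A t1 x1 x2 ->
      first_SBC x1 x2 t1 ->
      (A <= A0 -> ~ has_turning_point x2 t1) /\
      (A0 < A -> has_turning_point x2 t1).
Proof.
  set (N := fun A => exists th x1 x2 v1 v2, free_fall m A th x1 x2 v1 v2 /\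
    forall t, 0 < t < th -> 0 <= v2 t).
  destruct (reversal_large m hm) as [A1 [HA1 Hlarge]].
  (* Adjoining [1 / 2] makes the set nonempty without constructing a motion, and makes [A0]
     positive. *)
  destruct (completeness (fun A => A = 1 / 2 \/ N A)) as [A0 [Hub Hlub]].
  - exists (Rmax (1 / 2) A1). intros A [->|[th [x1 [x2 [v1 [v2 [FF Hv]]]]]]].
    + apply Rmax_l.
    + apply Rle_trans with A1; [|apply Rmax_r]. apply Rnot_lt_le. intro Hlt.
      destruct (Hlarge A th x1 x2 v1 v2 ltac:(lra) FF) as [t [Ht Hneg]].
      generalize (Hv t Ht). lra.
  - exists (1 / 2). now left.
  - assert (HA0 : 1 / 2 <= A0) by (apply Hub; now left).
    exists A0. split; [lra|]. intros A t1 x1 x2 HA HM HS.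
    destruct (turning_point_iff m A t1 x1 x2 hm HA HM HS) as [th [v1 [v2 [FF Hiff]]]].
    split.
    + intros Hle Htp. apply Hiff in Htp. destruct Htp as [ts [Hts Hneg]].
      destruct (Rle_or_lt A (1 / 2)) as [Hsmall|Hbig].
      { generalize (no_reversal_small _ _ _ _ _ _ _ hm (conj HA Hsmall) FF ts Hts). lra. }
      destruct (reversal_open _ _ _ _ _ _ _ _ hm HA FF Hts Hneg) as [eta [Heta Hopen]].
      assert (Hnear : exists B, N B /\ A - eta < B).
      { apply NNPP. intro Hn.
        (* The minimum keeps the smaller upper bound at or above the adjoined point [1 / 2]. *)
        assert (Hmn : 0 < Rmin eta (A - 1 / 2)) by (apply Rmin_pos; lra).
        assert (L1 := Rmin_l eta (A - 1 / 2)). assert (L2 := Rmin_r eta (A - 1 / 2)).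
        assert (A0 <= A - Rmin eta (A - 1 / 2)); [|lra].
        apply Hlub. intros B [->|HB]; [lra|]. apply Rnot_lt_le. intro Hlt.
        apply Hn. exists B. split; [exact HB|lra]. }
      destruct Hnear as [B [[th' [y1 [y2 [z1 [z2 [FF' Hz]]]]]] HB]].
      destruct (Rle_or_lt B A) as [HBA|HAB].
      * destruct (Hopen B th' y1 y2 z1 z2) as [t [Ht Hzt]];
          [apply Rabs_def1; lra|exact FF'|]. generalize (Hz t Ht). lra.
      * generalize (no_reversal_downward _ _ _ _ _ _ _ _ _ _ _ _ _ hm
          (conj HA HAB) FF' FF Hz ts Hts). lra.
    + intros Hlt. apply Hiff. apply NNPP. intro Hno.
      assert (A <= A0); [|lra]. apply Hub. right.
      exists th, x1, x2, v1, v2. split; [exact FF|]. intros t Ht.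
      apply Rnot_lt_le. intro. apply Hno. now exists t.
Qed.
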